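(* Let $t>0$, let $H$ be a Hermitian operator and $L_1,\dots,L_N$ operators on a finite-dimensional Hilbert space, and let $\gamma_1,\dots,\gamma_N:[0,t]\to\mathbb R$ be continuous (possibly taking negative values). Let $\rho:[0,t]\to$ operators be the solution of $$\frac{d\rho}{ds}=-i[H,\rho]+\mathcal L_D^s\rho,\qquad \mathcal L_D^s\sigma=\sum_{i=1}^N\gamma_i(s)\Big(L_i\sigma L_i^\dagger-\tfrac12\{L_i^\dagger L_i,\sigma\}\Big),$$ and assume $\rho(s)$ is a density operator for every $s\in[0,t]$. Let $\tilde\rho_n$ be the perturbative series truncated at order $n$, as defined in the context. Then: (a) There exist $\epsilon_1,\dots,\epsilon_N\in[0,t]$ such that $$D_1(\rho(t),\tilde\rho_0(t))\le\frac12\int_0^tds\,\|\mathcal L_D^s\|_{1\to1}\|\rho(s)\|_1\le\sum_{i=1}^N|\gamma_i(\epsilon_i)|\,\|L_i\|_\infty^2\,t .$$ (b) If $\|L_i\|_\infty=1$ for all $i$, then for every $n\ge0$ there exist points $\epsilon_{i,k}\in[0,t]$ ($1\le i\le N$, $0\le k\le n$) such that $$D_1(\rho(t),\tilde\rho_n(t))\le\prod_{k=0}^n\Big[2\sum_{i=1}^N|\gamma_i(\epsilon_{i,k})|\Big]\frac{t^{n+1}}{2(n+1)!}\le\frac{(2\bar\gamma Nt)^{n+1}}{2(n+1)!},\qquad \bar\gamma=\max_{i,\,s\in[0,t]}|\gamma_i(s)| .$$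
   Context: $\|A\|_1$ is the trace norm (sum of singular values), $\|A\|_\infty$ the operator norm (largest singular value), $D_1(\rho_1,\rho_2)=\tfrac12\|\rho_1-\rho_2\|_1$, and for a superoperator $\mathcal A$, $\|\mathcal A\|_{1\to1}=\sup_{\sigma\ne0}\|\mathcal A\sigma\|_1/\|\sigma\|_1$. With $\mathcal L_H\sigma=-i[H,\sigma]$, so that $e^{s\mathcal L_H}\sigma=e^{-iHs}\sigma e^{iHs}$, the series terms are $\rho_0(s)=e^{s\mathcal L_H}\rho(0)$ and $\rho_i(s)=\int_0^sdu\,e^{(s-u)\mathcal L_H}\mathcal L_D^u\rho_{i-1}(u)$ for $i\ge1$. The truncation is $\tilde\rho_n(s)=\sum_{i=0}^n\rho_i(s)$. Equivalently, $\tilde\rho_0(s)=e^{s\mathcal L_H}\rho(0)$ and $\tilde\rho_n(s)=e^{s\mathcal L_H}\rho(0)+\int_0^sdu\,e^{(s-u)\mathcal L_H}\mathcal L_D^u\tilde\rho_{n-1}(u)$ for $n\ge1$. *)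

(* Defs.v *)
From HB Require Import structures.
From mathcomp Require Import all_boot all_order all_algebra.
From mathcomp Require Import complex.
From mathcomp Require Import all_classical all_reals all_analysis.

Set Implicit Arguments.
Unset Strict Implicit.
Unset Printing Implicit Defensive.

Import Order.TTheory GRing.Theory Num.Theory.
Import numFieldNormedType.Exports.

Local Open Scope classical_set_scope.
Local Open Scope ring_scope.
Local Open Scope complex_scope.
Local Open Scope sesquilinear_scope.

Section Operators.
Context {R : realType} {d : nat}.

(* The finite-dimensional Hilbert space is 'cV[R[i]]_d with its standard inner
   product, i.e. an orthonormal basis is fixed; A ^t* is the adjoint of A. *)
Notation op := 'M[R[i]]_d.
Implicit Types (A B : op) (f : R -> op).

(* spectral_diag lists the eigenvalues of a normal matrix with multiplicity;
   those of A ^t* *m A are nonnegative reals. *)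
Definition singular_value A (j : 'I_d) : R :=
  Num.sqrt (complex.Re (spectral_diag (A ^t* *m A) 0 j)).

Definition trace_norm A : R := \sum_(j < d) singular_value A j.

Definition op_norm A : R := \big[Num.max/0]_(j < d) singular_value A j.

Definition trace_dist A B : R := 2^-1 * trace_norm (A - B).

Definition superop_norm (F : op -> op) : R :=
  sup [set trace_norm (F A) / trace_norm A | A in [set A : op | A != 0]].

Definition density_operator A : Prop :=
  [/\ A \is hermsymmx,
      forall v : 'cV[R[i]]_d, 0 <= (v ^t* *m A *m v) 0 0
    & \tr A = 1].

(* Limits, derivatives and integrals of operator-valued functions of a real
   variable are taken on the real and imaginary parts of each entry. *)
Definition op_lim (u : nat -> op) : op :=
  \matrix_(j, k) (limn (fun n => complex.Re (u n j k))
               +i* limn (fun n => complex.Im (u n j k))).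

Definition op_integral (a b : R) f : op :=
  \matrix_(j, k)
    ((\int[lebesgue_measure]_(u in `[a, b]) complex.Re (f u j k))
  +i* (\int[lebesgue_measure]_(u in `[a, b]) complex.Im (f u j k))).

(* Derivative at s relative to D; one-sided when s is an endpoint of an
   interval D. *)
Definition has_derivative_within (D : set R) (g : R -> R) (s l : R) : Prop :=
  (g r - g s) / (r - s) @[r --> within D s^'] --> l.

Definition op_has_derivative_within (D : set R) f (s : R) A : Prop :=
  forall j k,
    has_derivative_within D (fun r => complex.Re (f r j k)) s
      (complex.Re (A j k)) /\
    has_derivative_within D (fun r => complex.Im (f r j k)) s
      (complex.Im (A j k)).

(* The exponential series of s F, evaluated at A. *)
Definition superop_exp (s : R) (F : op -> op) A : op :=
  op_lim (fun n => \sum_(m < n) (s ^+ m / m`!%:R)%:C *: iter m F A).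

Definition hamiltonian_part (H : op) A : op := - 'i *: (H *m A - A *m H).

Definition dissipator N (L : 'I_N -> op) (gamma : 'I_N -> R -> R) (s : R) A
    : op :=
  \sum_(i < N) (gamma i s)%:C *:
    (L i *m A *m (L i) ^t*
     - 2^-1 *: ((L i) ^t* *m L i *m A + A *m ((L i) ^t* *m L i))).

Fixpoint series_term (H : op) N (L : 'I_N -> op) (gamma : 'I_N -> R -> R)
    (rho0 : op) (n : nat) (s : R) : op :=
  match n with
  | 0 => superop_exp s (hamiltonian_part H) rho0
  | m.+1 => op_integral 0 s (fun u =>
      superop_exp (s - u) (hamiltonian_part H)
        (dissipator L gamma u (series_term H L gamma rho0 m u)))
  end.

Definition truncated_series (H : op) N (L : 'I_N -> op)
    (gamma : 'I_N -> R -> R) (rho0 : op) (n : nat) (s : R) : op :=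
  \sum_(m < n.+1) series_term H L gamma rho0 m s.

End Operators.

Definition rate_values (R : realType) N (gamma : 'I_N -> R -> R) (t : R)
    : set R :=
  [set x | exists i, exists2 s, s \in `[0, t] & x = `|gamma i s|].

Definition max_rate (R : realType) N (gamma : 'I_N -> R -> R) (t : R) : R :=
  sup (rate_values gamma t).

(* For continuous rates the supremum is a maximum. *)
Lemma max_rate_attained (R : realType) N (gamma : 'I_N -> R -> R) (t : R) :
  (0 < N)%N -> 0 < t ->
  (forall i, {within `[0, t], continuous (gamma i)}) ->
  rate_values gamma t (max_rate gamma t) /\
  ubound (rate_values gamma t) (max_rate gamma t).
Proof.
move=> N0 t0 cg.
have cng i : {within `[0, t], continuous (fun s => `|gamma i s|)}.
  move=> x; apply: (@continuous_comp _ _ _ (gamma i : subspace _ -> R) Num.norm).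
    exact: cg.
  exact: norm_continuous.
have ex i : exists s, s \in `[0, t] /\
    forall r, r \in `[0, t] -> `|gamma i r| <= `|gamma i s|.
  by have [c ? ?] := EVT_max (ltW t0) (cng i); exists c.
have [c cP] := choice ex.
pose i0 := [arg max_(i > Ordinal N0) `|gamma i (c i)|]%O.
have i0max j : `|gamma j (c j)| <= `|gamma i0 (c i0)|.
  by rewrite /i0; case: arg_maxP => //= i _; apply.
have ub : ubound (rate_values gamma t) `|gamma i0 (c i0)|.
  move=> _ [i [s st ->]]; apply: le_trans (i0max i).
  exact: (cP i).2.
have mem : rate_values gamma t `|gamma i0 (c i0)|.
  by exists i0, (c i0) => //; exact: (cP i0).1.
have E : max_rate gamma t = `|gamma i0 (c i0)|.
  apply/eqP; rewrite eq_le; apply/andP; split.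
    by apply: ge_sup => //; exists `|gamma i0 (c i0)|.
  by apply: ub_le_sup => //; exists `|gamma i0 (c i0)|.
by rewrite E.
Qed.

(* Main.v *)
(** The trace norm is handled by duality: |tr (B A)| <= c ||A||_1 whenever
    ||u B|| <= c ||u|| for all u (Cauchy-Schwarz in a singular basis of A), with
    equality attained by a contraction B.  Hence ||.||_1 is a norm,
    ||A B||_1 <= ||A||_oo ||B||_1, and
    ||L_D^s A||_1 <= 2 sum_i |gamma_i(s)| ||L_i||_oo^2 ||A||_1.
    In an eigenbasis of H the exponential series of the Hamiltonian part sums to
    conjugation by a unitary E(s); differentiating E(-s) rho(s) E(s) gives the
    Duhamel identity
      rho(s) = e^{s L_H} rho(0) + int_0^s e^{(s-u) L_H} L_D^u rho(u) du,
    so the truncation error d_n = rho - rho~_n satisfies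
      d_n(s) = int_0^s e^{(s-u) L_H} L_D^u d_{n-1}(u) du,  d_{-1} = rho.
    With eps_i a maximiser of |gamma_i| on [0, t] and ||rho(s)||_1 = 1, iterating
    this integral yields the factor s^{n+1} / (n+1)!. *)

From HB Require Import structures.
Require Import Defs.
From mathcomp Require Import all_boot all_order all_algebra.
From mathcomp Require Import complex.
From mathcomp Require Import all_classical all_reals all_analysis.
From mathcomp Require Import ring.

Import Order.TTheory GRing.Theory Num.Theory.
Import numFieldNormedType.Exports.

Local Open Scope classical_set_scope.
Local Open Scope ring_scope.
Local Open Scope complex_scope.
Local Open Scope sesquilinear_scope.

Set Implicit Arguments.
Unset Strict Implicit.
Unset Printing Implicit Defensive.

(** * Trace norm *)

(** The Euclidean norm of a row vector, valued in [R] rather than [R[i]]; locked so that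
    simplification does not expose the form under the root. *)
HB.lock Definition vnorm (R : realType) d (u : 'rV[R[i]]_d) : R :=
  Num.sqrt (complex.Re (dotmx u u)).

Section TraceNorm.
Context {R : realType}.
Local Notation C := R[i].

Lemma dotmx_mulmx_adj d (B : 'M[C]_d) (u v : 'rV[C]_d) :
  dotmx (u *m B) v = dotmx u (v *m B^t*).
Proof. by rewrite !dotmxE trmx_mul map_mxM /= trmxCK mulmxA. Qed.

Lemma vnorm_ge0 d (u : 'rV[C]_d) : 0 <= vnorm u.
Proof. rewrite vnorm.unlock; exact: sqrtr_ge0. Qed.

Lemma dotmx_vnorm d (u : 'rV[C]_d) : dotmx u u = (vnorm u ^+ 2)%:C.
Proof.
have /ger0_real/RRe_real u0 : 0 <= dotmx u u by exact: dnorm_ge0.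
rewrite vnorm.unlock sqr_sqrtr ?u0// -lecR u0; exact: dnorm_ge0.
Qed.

Lemma dotmx_sum d (u v : 'rV[C]_d) : dotmx u v = \sum_j u 0 j * (v 0 j)^*.
Proof. by rewrite dotmxE mxE; apply: eq_bigr => j _; rewrite !mxE. Qed.

Lemma CauchySchwarz_vnorm d (u v : 'rV[C]_d) :
  `|dotmx u v| <= (vnorm u * vnorm v)%:C.
Proof.
have : `|dotmx u v| ^+ 2 <= dotmx u u * dotmx v v.
  exact: (CauchySchwarz (@dotmx C d) u v).1.
rewrite !dotmx_vnorm -rmorphM -exprMn -add_Re2_Im2 lecR normc_def lecR => uv.
by rewrite -[leRHS]ger0_norm ?mulr_ge0 ?vnorm_ge0// -sqrtr_sqr ler_wsqrtr.
Qed.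

(* Matrices act on row vectors from the right throughout, matching dotmx; the
   bound is insensitive to this choice by bounded_mx_adj. *)
Definition bounded_mx d (c : R) (B : 'M[C]_d) :=
  forall u : 'rV_d, vnorm (u *m B) <= c * vnorm u.

Lemma bounded_mxM d (c e : R) (A B : 'M[C]_d) : 0 <= e ->
  bounded_mx c A -> bounded_mx e B -> bounded_mx (c * e) (A *m B).
Proof.
move=> e0 cA eB u; rewrite mulmxA; apply: le_trans (eB _) _.
rewrite (mulrC c) -mulrA; exact: (ler_wpM2l e0 (cA u)).
Qed.

(** With $w = uA^\dagger$, $\|w\|^2 = \langle u, wA\rangle \le \|u\|\, c\,\|w\|$; then divide by
    $\|w\|$. *)
Lemma bounded_mx_adj d (c : R) (A : 'M[C]_d) : bounded_mx c A ->
  bounded_mx c (A^t*).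
Proof.
move=> cA u; have [->|u0] := eqVneq (vnorm (u *m A^t*)) 0.
  exact: le_trans (vnorm_ge0 (u *m A)) (cA u).
have {}u0 : 0 < vnorm (u *m A^t*) by rewrite lt0r u0 vnorm_ge0.
rewrite -(ler_pM2r u0) -expr2 -lecR -dotmx_vnorm.
rewrite {1}dotmx_mulmx_adj trmxCK.
have -> : dotmx u (u *m A^t* *m A) = `|dotmx u (u *m A^t* *m A)|.
  rewrite ger0_norm//; have := dotmx_mulmx_adj (A^t*) u (u *m A^t*).
  by rewrite trmxCK => <-; exact: dnorm_ge0.
apply: le_trans (CauchySchwarz_vnorm _ _) _; rewrite lecR.
by rewrite mulrAC mulrC ler_wpM2r ?vnorm_ge0.
Qed.

Lemma unitarymx_bounded d (A : 'M[C]_d) : A \is unitarymx -> bounded_mx 1 A.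
Proof.
move=> /unitarymxP AA u.
by rewrite mul1r !vnorm.unlock dotmx_mulmx_adj -mulmxA AA mulmx1.
Qed.

Lemma bounded_mx1 d : bounded_mx 1 (1%:M : 'M[C]_d).
Proof. by move=> u; rewrite mulmx1 mul1r. Qed.

Lemma vnorm_row_unitary d (A : 'M[C]_d) j : A \is unitarymx ->
  vnorm (row j A) = 1.
Proof. by move=> /row_unitarymxP uA; rewrite vnorm.unlock uA eqxx sqrtr1. Qed.

Lemma row_mul_dotmx d (A B M : 'M[C]_d) j :
  (A *m M *m B^t*) j j = dotmx (row j A *m M) (row j B).
Proof. by rewrite dotmxE -row_mul !mxE; apply: eq_bigr => k _; rewrite !mxE. Qed.

(** * Singular values through the eigenbasis of [A^t* *m A] *)

Lemma mulmx_adj_hermsym d (A : 'M[C]_d) : A^t* *m A \is hermsymmx.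
Proof.
by apply/is_hermitianmxP; rewrite expr0 scale1r trmx_mul map_mxM /= trmxCK.
Qed.

Lemma hermsym_spectralE d (A : 'M[C]_d) : A \is hermsymmx ->
  spectralmx A *m A *m (spectralmx A)^t* = diag_mx (spectral_diag A).
Proof.
move=> /hermitian_normalmx/orthomx_spectralP {2}->.
have Vu := spectral_unitarymx A; rewrite invmx_unitary// !mulmxA.
by rewrite (unitarymxP Vu) mul1mx -mulmxA (unitarymxP Vu) mulmx1.
Qed.

(** For the $j$-th eigenrow $v_j$, the eigenvalue is $v_j A^\dagger A v_j^\dagger = \|v_j
    A^\dagger\|^2$. It is therefore real and nonnegative, and neither the real part nor the root in
    [singular_value] loses anything. *)
Lemma spectral_diag_singular d (A : 'M[C]_d) j :
  spectral_diag (A^t* *m A) 0 j = (singular_value A j ^+ 2)%:C /\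
  singular_value A j = vnorm (row j (spectralmx (A^t* *m A)) *m A^t*).
Proof.
set M := A^t* *m A; set V := spectralmx M.
have E : spectral_diag M 0 j = dotmx (row j V *m A^t*) (row j V *m A^t*).
  rewrite dotmx_mulmx_adj -mulmxA trmxCK.
  transitivity (diag_mx (spectral_diag M) j j); first by rewrite !mxE eqxx.
  by rewrite -hermsym_spectralE ?mulmx_adj_hermsym// row_mul_dotmx
     dotmx_mulmx_adj -/M (trmx_mul _ _) map_mxM /= trmxCK.
have E2 : singular_value A j = vnorm (row j V *m A^t*).
  by rewrite /singular_value -/M E vnorm.unlock.
by rewrite E2 E dotmx_vnorm.
Qed.

Lemma normc_sum_le (I : finType) (f : I -> C) (g : I -> R) :
  (forall i, `|f i| <= (g i)%:C) -> `|\sum_i f i| <= (\sum_i g i)%:C.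
Proof.
move=> fg; apply: le_trans (ler_norm_sum _ _ _) _.
by rewrite rmorph_sum; apply: ler_sum => i _; exact: fg.
Qed.

(** Computed in the eigenbasis $(v_j)$, the trace is $\sum_j \langle v_j B, v_j A^\dagger\rangle$.
    Cauchy-Schwarz bounds each term by $c$ times the singular value $\|v_j A^\dagger\|$. *)
Lemma normc_tr_mul_le d (c : R) (A B : 'M[C]_d) : bounded_mx c B ->
  `|\tr (B *m A)| <= (c * trace_norm A)%:C.
Proof.
move=> cB; set V := spectralmx (A^t* *m A).
have Vu : V \is unitarymx by exact: spectral_unitarymx.
have -> : \tr (B *m A) = \sum_j dotmx (row j V *m B) (row j V *m A^t*).
  rewrite -[B *m A]mulmx1 -(mulmx1C (unitarymxP Vu)) mulmxA.
  rewrite mxtrace_mulC; apply: eq_bigr => j _.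
  rewrite !mulmxA -[X in (X *m V^t*) j j]mulmxA row_mul_dotmx.
  by rewrite mulmxA dotmx_mulmx_adj.
rewrite /trace_norm mulr_sumr; apply: normc_sum_le => j.
apply: le_trans (CauchySchwarz_vnorm _ _) _; rewrite lecR.
have [_ ->] := spectral_diag_singular A j.
apply: ler_wpM2r; first exact: vnorm_ge0.
by apply: le_trans (cB _) _; rewrite vnorm_row_unitary// mulr1.
Qed.

Lemma singular_value_ge0 d (A : 'M[C]_d) j : 0 <= singular_value A j.
Proof. exact: sqrtr_ge0. Qed.

Lemma trace_norm_ge0 d (A : 'M[C]_d) : 0 <= trace_norm A.
Proof. by apply: sumr_ge0 => j _; exact: singular_value_ge0. Qed.

Lemma vnorm_sum d (u : 'rV[C]_d) : (vnorm u ^+ 2)%:C = \sum_j `|u 0 j| ^+ 2.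
Proof.
by rewrite -dotmx_vnorm dotmx_sum; apply: eq_bigr => j _; rewrite -normCK.
Qed.

Lemma vnorm_le d (c : R) (u v : 'rV[C]_d) : 0 <= c ->
  (vnorm u ^+ 2)%:C <= (c ^+ 2)%:C * (vnorm v ^+ 2)%:C ->
  vnorm u <= c * vnorm v.
Proof.
move=> c0; rewrite -rmorphM -exprMn lecR.
by rewrite ler_sqr ?nnegrE ?mulr_ge0 ?vnorm_ge0.
Qed.

Lemma vnorm_unitary d (A : 'M[C]_d) (u : 'rV[C]_d) : A \is unitarymx ->
  vnorm (u *m A) = vnorm u.
Proof.
by move=> /unitarymxP AA; rewrite !vnorm.unlock dotmx_mulmx_adj -mulmxA AA mulmx1.
Qed.

Lemma vnorm_unitary_adj d (A : 'M[C]_d) (u : 'rV[C]_d) : A \is unitarymx ->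
  vnorm (u *m A^t*) = vnorm u.
Proof. by rewrite -trmxC_unitary; exact: vnorm_unitary. Qed.

(** In eigenbasis coordinates [x], the form of $A^\dagger A$ is diagonal with weights $\sigma_j^2$.
    Both the operator-norm bound and the dual contraction reduce to comparing these weights. *)
Lemma vnorm_mul_adj d (A : 'M[C]_d) (x : 'rV[C]_d) :
  (vnorm (x *m spectralmx (A^t* *m A) *m A^t*) ^+ 2)%:C =
  \sum_j (singular_value A j ^+ 2)%:C * `|x 0 j| ^+ 2.
Proof.
set M := A^t* *m A; set V := spectralmx M.
rewrite -dotmx_vnorm -[x *m V *m _]mulmxA dotmx_mulmx_adj.
have -> : x *m (V *m A^t*) *m (V *m A^t*)^t* = x *m diag_mx (spectral_diag M).
  rewrite -hermsym_spectralE ?mulmx_adj_hermsym// /M -/V.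
  by rewrite trmx_mul map_mxM /= trmxCK !mulmxA.
rewrite mul_mx_diag dotmx_sum; apply: eq_bigr => j _; rewrite !mxE.
have [-> _] := spectral_diag_singular A j.
rewrite rmorphM /= mulrA -normCK mulrC; congr (_ * _).
by apply: CrealP; rewrite complex_real.
Qed.

Lemma singular_value_le_op_norm d (A : 'M[C]_d) j :
  singular_value A j <= op_norm A.
Proof. exact: (le_bigmax _ (singular_value A)). Qed.

Lemma op_norm_ge0 d (A : 'M[C]_d) : 0 <= op_norm A.
Proof. exact: bigmax_ge_id. Qed.

(** Every weight $\sigma_j^2$ is at most the square of the largest one. The adjoint comes first
    because rows are multiplied from the right. *)
Lemma bounded_mx_op_norm_adj d (A : 'M[C]_d) : bounded_mx (op_norm A) (A^t*).
Proof.
move=> u; set V := spectralmx (A^t* *m A).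
have Vu : V \is unitarymx by exact: spectral_unitarymx.
apply: vnorm_le; first exact: op_norm_ge0.
have {1}-> : u = u *m V^t* *m V.
  by rewrite -mulmxA (mulmx1C (unitarymxP Vu)) mulmx1.
rewrite (vnorm_mul_adj A (u *m V^t*)).
rewrite -(vnorm_unitary_adj u Vu).
rewrite vnorm_sum mulr_sumr; apply: ler_sum => j _.
apply: ler_wpM2r; first by rewrite exprn_ge0.
rewrite lecR ler_sqr ?nnegrE ?op_norm_ge0 ?singular_value_ge0//.
exact: singular_value_le_op_norm.
Qed.

Lemma bounded_mx_op_norm d (A : 'M[C]_d) : bounded_mx (op_norm A) A.
Proof.
rewrite -[X in bounded_mx _ X]trmxCK.
exact/bounded_mx_adj/bounded_mx_op_norm_adj.
Qed.

(** The witness is $B = |A|^{-1} A^\dagger$, the adjoint of the polar factor of $A$, so that $BA =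
    |A|^{-1}|A|^2$ has trace $\sum_j \sigma_j$. *)
Lemma trace_norm_dual d (A : 'M[C]_d) :
  exists2 B, bounded_mx 1 B & \tr (B *m A) = (trace_norm A)%:C.
Proof.
set M := A^t* *m A; set V := spectralmx M.
have Vu : V \is unitarymx by exact: spectral_unitarymx.
(* Since the inverse of [0] is [0], this is a pseudo-inverse of $|A|$ in the eigenbasis when some
   singular values vanish. *)
pose S := diag_mx (\row_j ((singular_value A j)^-1)%:C) : 'M[C]_d.
exists (V^t* *m S *m V *m A^t*); last first.
  rewrite -!mulmxA mxtrace_mulC -mulmxA -[V *m _ *m _]mulmxA.
  rewrite [V *m (_ *m _)]mulmxA hermsym_spectralE ?mulmx_adj_hermsym//.
  rewrite mul_diag_mx rmorph_sum; apply: eq_bigr => j _; rewrite !mxE eqxx mulr1n.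
  have [-> _] := spectral_diag_singular A j; rewrite -rmorphM /=.
  have [->|s0] := eqVneq (singular_value A j) 0; first by rewrite expr0n mulr0.
  by rewrite expr2 mulKf.
move=> u; apply: vnorm_le; first exact: ler01.
rewrite !(mulmxA u) (vnorm_mul_adj A (u *m V^t* *m S)).
rewrite -(vnorm_unitary_adj u Vu).
rewrite vnorm_sum expr1n mul1r; apply: ler_sum => j _.
(* The weight of each coordinate is $(\sigma_j \sigma_j^{-1})^2$, which is 0 or 1. *)
rewrite mul_mx_diag !mxE normrM exprMn mulrCA ler_piMr ?exprn_ge0//.
rewrite -normrX -rmorphXn /= -[X in `|X|]/(_%:C) ger0_norm ?ler0c ?sqr_ge0//.
rewrite -rmorphM lecR -exprMn.
have [->|s0] := eqVneq (singular_value A j) 0; first by rewrite mul0r expr0n.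
by rewrite divff// expr1n.
Qed.

(** * Trace-norm inequalities by duality *)

Lemma Re_le_normc (z : C) (c : R) : `|z| <= c%:C -> complex.Re z <= c.
Proof.
rewrite normc_def lecR; apply: le_trans; apply: le_trans (ler_norm _) _.
by rewrite -sqrtr_sqr ler_wsqrtr// lerDl sqr_ge0.
Qed.

(** Testing real parts suffices because the dual contraction attains a real trace. Bounds on the
    trace norm thus reduce to bounds on linear functionals. *)
Lemma trace_norm_le d (A : 'M[C]_d) (c : R) :
  (forall B, bounded_mx 1 B -> complex.Re (\tr (B *m A)) <= c) ->
  trace_norm A <= c.
Proof. by have [B B1 BA] := trace_norm_dual A => /(_ B B1); rewrite BA. Qed.

Lemma Re_tr_mul_le d (c : R) (A B : 'M[C]_d) : bounded_mx c B ->
  complex.Re (\tr (B *m A)) <= c * trace_norm A.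
Proof. by move=> cB; exact/Re_le_normc/normc_tr_mul_le. Qed.

(** By cyclicity $\mathrm{tr}(DAB) = \mathrm{tr}(BDA)$, and $BD$ is bounded by $c$ when $D$ is a
    contraction. *)
Lemma trace_norm_mulr d (c : R) (A B : 'M[C]_d) : 0 <= c -> bounded_mx c B ->
  trace_norm (A *m B) <= c * trace_norm A.
Proof.
move=> c0 cB; apply: trace_norm_le => D D1; rewrite mulmxA mxtrace_mulC mulmxA.
apply: Re_tr_mul_le; rewrite -[c]mulr1; exact: bounded_mxM.
Qed.

Lemma trace_norm_mull d (c : R) (A B : 'M[C]_d) : 0 <= c -> bounded_mx c B ->
  trace_norm (B *m A) <= c * trace_norm A.
Proof.
move=> c0 cB; apply: trace_norm_le => D D1; rewrite mulmxA.
apply: Re_tr_mul_le; rewrite -[c]mul1r; exact: bounded_mxM.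
Qed.

Lemma trace_normD d (A B : 'M[C]_d) :
  trace_norm (A + B) <= trace_norm A + trace_norm B.
Proof.
apply: trace_norm_le => D D1; rewrite mulmxDr linearD raddfD /=.
by apply: lerD; rewrite -[leRHS]mul1r; exact: Re_tr_mul_le.
Qed.

Lemma bounded_mxZ d (a : C) (c e : R) (B : 'M[C]_d) : `|a| = e%:C ->
  bounded_mx c B -> bounded_mx (e * c) (a *: B).
Proof.
move=> ae cB u; rewrite -scalemxAr -mulrA.
have e0 : 0 <= e by rewrite -ler0c -ae normr_ge0.
apply: (@le_trans _ _ (e * vnorm (u *m B))); last exact: (ler_wpM2l e0 (cB u)).
apply: vnorm_le => //; rewrite !vnorm_sum mulr_sumr; apply: ler_sum => j _.
by rewrite mxE normrM exprMn ae rmorphXn.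
Qed.

Lemma trace_normZ d (a : C) (A : 'M[C]_d) (e : R) : `|a| = e%:C ->
  trace_norm (a *: A) <= e * trace_norm A.
Proof.
move=> ae; apply: trace_norm_le => D D1; rewrite -scalemxAr scalemxAl.
apply: Re_tr_mul_le; rewrite -[e]mulr1; exact: bounded_mxZ.
Qed.

Lemma trace_norm0 d : trace_norm (0 : 'M[C]_d) = 0.
Proof.
have [B _] := trace_norm_dual (0 : 'M[C]_d).
by rewrite mulmx0 mxtrace0 => /complexI.
Qed.

Lemma trace_norm_sum (I : finType) d (F : I -> 'M[C]_d) :
  trace_norm (\sum_i F i) <= \sum_i trace_norm (F i).
Proof.
apply: (big_ind2 (fun A x => trace_norm A <= x)); rewrite ?trace_norm0//.
by move=> A x B y Ax By; apply: le_trans (trace_normD _ _) _; exact: lerD.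
Qed.

(** A vanishing trace norm makes $\mathrm{tr}(BA)$ vanish for every $B$; matrix units then extract
    each entry of $A$. *)
Lemma trace_norm_gt0 d (A : 'M[C]_d) : A != 0 -> 0 < trace_norm A.
Proof.
move=> A0; rewrite lt0r trace_norm_ge0 andbT; apply: contra A0 => /eqP tA.
apply/eqP/matrixP => j k; rewrite mxE.
have trE (B : 'M[C]_d) : \tr (B *m A) = 0.
  have := normc_tr_mul_le A (bounded_mx_op_norm B).
  by rewrite tA mulr0 normr_le0 => /eqP.
have := trE (delta_mx k j); rewrite /mxtrace (bigD1 k)//= mxE (bigD1 j)//=.
rewrite mxE !eqxx mul1r big1 ?addr0.
  rewrite big1 ?addr0// => l lk; rewrite mxE big1// => m _.
  by rewrite mxE (negbTE lk) mul0r.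
by move=> l lj; rewrite mxE (negbTE lj) andbF mul0r.
Qed.

(** The identity as test matrix gives the lower bound $\mathrm{tr}\,A = 1$. For the upper bound, the
    eigenvalues are nonnegative with sum 1, so $\mathrm{tr}(BA)$ is a convex combination of the
    numbers $\langle v_j B, v_j\rangle$, each of modulus at most 1. *)
Lemma trace_norm_density d (A : 'M[C]_d) : density_operator A -> trace_norm A = 1.
Proof.
move=> [hA pA tA]; apply/eqP; rewrite eq_le; apply/andP; split; last first.
  have := Re_tr_mul_le A (@bounded_mx1 d).
  by rewrite mul1mx tA mul1r.
have Vu := spectral_unitarymx A; have VA := hermsym_spectralE hA.
set V := spectralmx A in Vu VA; set D := spectral_diag A in VA.
have AE : A = V^t* *m diag_mx D *m V.
  by rewrite -VA !mulmxA (mulmx1C (unitarymxP Vu)) mul1mx -mulmxA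
             (mulmx1C (unitarymxP Vu)) mulmx1.
have D0 j : 0 <= D 0 j.
  have := pA ((row j V)^t*); rewrite trmxCK -dotmxE -row_mul_dotmx VA.
  by rewrite !mxE eqxx.
have D1 : \sum_j D 0 j = 1.
  by rewrite -tA {1}AE -mulmxA mxtrace_mulC -mulmxA (unitarymxP Vu) mulmx1
             mxtrace_diag.
apply: trace_norm_le => B B1.
apply: Re_le_normc; rewrite [in X in X <= _]AE !mulmxA mxtrace_mulC !mulmxA mul_mx_diag.
apply: le_trans (ler_norm_sum _ _ _) _; rewrite -[leRHS]D1.
apply: ler_sum => j _; rewrite mxE row_mul_dotmx normrM.
rewrite (ger0_norm (D0 j)) ler_piMl//.
apply: le_trans (CauchySchwarz_vnorm _ _) _.
rewrite vnorm_row_unitary// mulr1 lecR; apply: le_trans (B1 _) _.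
by rewrite vnorm_row_unitary// mulr1.
Qed.

(** * The induced norm of superoperators *)

Section SuperopNorm.
Context {d : nat}.
Implicit Types (F G : 'M[C]_d -> 'M[C]_d) (c : R).

Lemma superop_norm_le F c : 0 <= c ->
  (forall A, trace_norm (F A) <= c * trace_norm A) -> superop_norm F <= c.
Proof.
move=> c0 Fc; rewrite /superop_norm; set S := [set _ | _ in _].
(* In dimension 0 there is no nonzero operator, and [sup] of the empty set is [0]. *)
have [->|/set0P S0] := eqVneq S set0; first by rewrite sup0.
apply: ge_sup => // _ [A A0 <-].
by rewrite ler_pdivrMr ?trace_norm_gt0.
Qed.

(** The bound [Fc], with any constant, makes the set of quotients bounded above, so that [sup] is a
    genuine supremum. At [A = 0], outside that set, it forces [F 0] to have trace norm 0. *)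
Lemma le_superop_norm F c A :
  (forall A, trace_norm (F A) <= c * trace_norm A) ->
  trace_norm (F A) <= superop_norm F * trace_norm A.
Proof.
move=> Fc; have [->|A0] := eqVneq A 0.
  by have := Fc 0; rewrite trace_norm0 !mulr0.
rewrite -ler_pdivrMr ?trace_norm_gt0//; apply: ub_le_sup; last by exists A.
by exists c => _ [B B0 <-]; rewrite ler_pdivrMr ?trace_norm_gt0.
Qed.

Lemma superop_norm_ge0 F c :
  (forall A, trace_norm (F A) <= c * trace_norm A) -> 0 <= superop_norm F.
Proof.
move=> Fc; rewrite /superop_norm; set S := [set _ | _ in _].
have [->|/set0P[x Sx]] := eqVneq S set0; first by rewrite sup0.
apply: (@le_trans _ _ x); last first.
  apply: ub_le_sup => //.
  by exists c => _ [B B0 <-]; rewrite ler_pdivrMr ?trace_norm_gt0.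
by case: Sx => A A0 <-; rewrite divr_ge0 ?trace_norm_ge0.
Qed.

(** One half of the reverse triangle inequality; used with both orders of two times, it gives
    continuity of the norm of the dissipator. *)
Lemma superop_normB_le F G c e : 0 <= e ->
  (forall A, trace_norm (G A) <= c * trace_norm A) ->
  (forall A, trace_norm (F A - G A) <= e * trace_norm A) ->
  superop_norm F <= superop_norm G + e.
Proof.
move=> e0 Gc FG; apply: superop_norm_le => [|A].
  by rewrite addr_ge0// (superop_norm_ge0 Gc).
rewrite mulrDl -[F A](subrK (G A)) addrC.
apply: le_trans (trace_normD _ _) _; apply: lerD; last exact: FG.
exact: le_superop_norm Gc.
Qed.

End SuperopNorm.

(** * Norm bounds for the dissipator *)

Lemma normc_real (x : R) : `|x%:C| = `|x|%:C :> C.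
Proof. by rewrite normc_def /= expr0n addr0 sqrtr_sqr. Qed.

(** The rates enter as plain numbers, so that the same bound serves for rates at one time, for
    maximal rates and for differences of rates. *)
Definition diss_bound N d (L : 'I_N -> 'M[C]_d) (g : 'I_N -> R) : R :=
  \sum_(i < N) `|g i| * (2 * op_norm (L i) ^+ 2).

Lemma diss_bound_ge0 N d (L : 'I_N -> 'M[C]_d) g : 0 <= diss_bound L g.
Proof.
by apply: sumr_ge0 => i _; rewrite !mulr_ge0 ?normr_ge0 ?exprn_ge0 ?op_norm_ge0.
Qed.

(** For each [i], the jump term $L A L^\dagger$ costs $\|L\|_\infty^2$, and so does half the
    anticommutator; hence the factor 2. *)
Lemma trace_norm_dissipator N d (L : 'I_N -> 'M[C]_d) gamma s A :
  trace_norm (dissipator L gamma s A) <=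
  diss_bound L (fun i => gamma i s) * trace_norm A.
Proof.
rewrite /dissipator mulr_suml; apply: le_trans (trace_norm_sum _) _.
apply: ler_sum => i _; rewrite -mulrA.
apply: le_trans (trace_normZ _ (normc_real _)) _.
apply: ler_wpM2l; first exact: normr_ge0.
have l0 := op_norm_ge0 (L i); set l := op_norm (L i) in l0 *.
have Ll := bounded_mx_op_norm (L i); have Ll' := bounded_mx_op_norm_adj (L i).
have LL : bounded_mx (l ^+ 2) ((L i)^t* *m L i) by exact: bounded_mxM.
have l20 : 0 <= l ^+ 2 by exact: exprn_ge0.
rewrite mulrDl mul1r mulrDl; apply: le_trans (trace_normD _ _) _; apply: lerD.
  apply: le_trans (trace_norm_mulr _ l0 Ll') _; rewrite expr2 -mulrA.
  by apply: ler_wpM2l => //; exact: trace_norm_mull.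
rewrite -scaleNr; apply: (@le_trans _ _ (2^-1 * trace_norm
    ((L i)^t* *m L i *m A + A *m ((L i)^t* *m L i)))).
  apply: trace_normZ; rewrite normrN -[2^-1]/((2%:R)^-1) -(rmorph_nat (real_complex R)).
  by rewrite -fmorphV normc_real ger0_norm// invr_ge0.
rewrite ler_pdivrMl//; apply: le_trans (trace_normD _ _) _.
by rewrite mulrDl mul1r; apply: lerD; [exact: trace_norm_mull|exact: trace_norm_mulr].
Qed.

(** The dissipator is linear in its rates. On the right they are constant in time, so the time [0]
    is a placeholder. *)
Lemma dissipatorB_rates N d (L : 'I_N -> 'M[C]_d) gamma u v A :
  dissipator L gamma u A - dissipator L gamma v A =
  dissipator L (fun i _ => gamma i u - gamma i v) 0 A.
Proof.
by rewrite -sumrB; apply: eq_bigr => i _; rewrite -scalerBl -rmorphB.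
Qed.

End TraceNorm.

(** * Entrywise limits, derivatives and integrals *)

Section MatrixLimits.
Context {R : realType}.
Local Notation C := R[i].

Lemma complex_ReM (a b : C) : complex.Re (a * b) =
  complex.Re a * complex.Re b - complex.Im a * complex.Im b.
Proof. by case: a b => [? ?] [? ?]. Qed.

Lemma complex_ImM (a b : C) : complex.Im (a * b) =
  complex.Re a * complex.Im b + complex.Im a * complex.Re b.
Proof. by case: a b => [? ?] [? ?]. Qed.

Lemma complex_ReD (a b : C) : complex.Re (a + b) = complex.Re a + complex.Re b.
Proof. by case: a b => [? ?] [? ?]. Qed.

Lemma complex_ImD (a b : C) : complex.Im (a + b) = complex.Im a + complex.Im b.
Proof. by case: a b => [? ?] [? ?]. Qed.

(** * Convergence of complex numbers and matrices along a filter *)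

Section Filter.
Context {T : Type} {F : set_system T} {FF : Filter F}.

(** Convergence is stated on real and imaginary parts to match the entrywise definitions of limits,
    derivatives and integrals of operators. *)
Definition ccvg (f : T -> C) (l : C) :=
  (complex.Re (f x) @[x --> F] --> complex.Re l) /\
  (complex.Im (f x) @[x --> F] --> complex.Im l).

Lemma ccvg_cst (l : C) : ccvg (fun=> l) l.
Proof. by split; exact: cvg_cst. Qed.

Lemma ccvgD f g a b : ccvg f a -> ccvg g b -> ccvg (fun x => f x + g x) (a + b).
Proof.
move=> [f1 f2] [g1 g2]; split.
  by rewrite complex_ReD; under eq_fun do rewrite complex_ReD; exact: cvgD.
by rewrite complex_ImD; under eq_fun do rewrite complex_ImD; exact: cvgD.
Qed.

Lemma ccvgM f g a b : ccvg f a -> ccvg g b -> ccvg (fun x => f x * g x) (a * b).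
Proof.
move=> [f1 f2] [g1 g2]; split.
  by rewrite complex_ReM; under eq_fun do rewrite complex_ReM; apply: cvgB; exact: cvgM.
by rewrite complex_ImM; under eq_fun do rewrite complex_ImM; apply: cvgD; exact: cvgM.
Qed.

Lemma ccvg_sum (I : Type) (r : seq I) (f : I -> T -> C) (a : I -> C) :
  (forall i, ccvg (f i) (a i)) ->
  ccvg (fun x => \sum_(i <- r) f i x) (\sum_(i <- r) a i).
Proof.
move=> fa; elim: r => [|i s IH].
  by rewrite big_nil; under eq_fun do rewrite big_nil; exact: ccvg_cst.
by rewrite big_cons; under eq_fun do rewrite big_cons; exact: ccvgD.
Qed.

Definition mcvg m n (f : T -> 'M[C]_(m, n)) (A : 'M[C]_(m, n)) :=
  forall j k, ccvg (fun x => f x j k) (A j k).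

Lemma mcvg_cst m n (A : 'M[C]_(m, n)) : mcvg (fun=> A) A.
Proof. by move=> j k; exact: ccvg_cst. Qed.

Lemma mcvgD m n (f g : T -> 'M[C]_(m, n)) A B :
  mcvg f A -> mcvg g B -> mcvg (fun x => f x + g x) (A + B).
Proof.
by move=> fA gB j k; rewrite mxE; under eq_fun do rewrite mxE; exact: ccvgD.
Qed.

Lemma mcvgZ m n (c : T -> C) (f : T -> 'M[C]_(m, n)) a A :
  ccvg c a -> mcvg f A -> mcvg (fun x => c x *: f x) (a *: A).
Proof.
by move=> ca fA j k; rewrite mxE; under eq_fun do rewrite mxE; exact: ccvgM.
Qed.

Lemma mcvgB m n (f g : T -> 'M[C]_(m, n)) A B :
  mcvg f A -> mcvg g B -> mcvg (fun x => f x - g x) (A - B).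
Proof.
move=> fA gB; rewrite -scaleN1r; under eq_fun do rewrite -scaleN1r.
by apply: mcvgD => //; apply: mcvgZ => //; exact: ccvg_cst.
Qed.

Lemma mcvgM m n p (f : T -> 'M[C]_(m, n)) (g : T -> 'M[C]_(n, p)) A B :
  mcvg f A -> mcvg g B -> mcvg (fun x => f x *m g x) (A *m B).
Proof.
move=> fA gB j k; rewrite mxE; under eq_fun do rewrite mxE.
by apply: ccvg_sum => i; exact: ccvgM.
Qed.

Lemma mcvg_sum (I : Type) (r : seq I) m n (f : I -> T -> 'M[C]_(m, n)) A :
  (forall i, mcvg (f i) (A i)) ->
  mcvg (fun x => \sum_(i <- r) f i x) (\sum_(i <- r) A i).
Proof.
move=> fA j k; rewrite summxE; under eq_fun do rewrite summxE.
by apply: ccvg_sum => i; exact: fA.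
Qed.

End Filter.

Arguments ccvg {T} F f l.
Arguments mcvg {T} F {m n} f A.

Lemma ccvg_real T (F : set_system T) {FF : Filter F} (f : T -> R) (l : R) :
  f x @[x --> F] --> l -> ccvg F (fun x => (f x)%:C) l%:C.
Proof. by move=> fl; split => //=; exact: cvg_cst. Qed.

Lemma op_lim_mcvg d (u : nat -> 'M[C]_d) A : mcvg \oo u A -> op_lim u = A.
Proof.
move=> uA; apply/matrixP => j k; rewrite mxE.
have [u1 u2] := uA j k; rewrite (cvg_lim _ u1)// (cvg_lim _ u2)//.
by case: (A j k).
Qed.

(** * Continuity and derivatives relative to a set *)

Definition mcontinuous_within m n (D : set R) (f : R -> 'M[C]_(m, n)) :=
  forall s, D s -> mcvg (within D (nbhs s)) f (f s).

(** Keeping the difference quotient as a matrix allows a product rule without entries;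
    [op_has_derivative_withinE] relates it to the entrywise notion. *)
Definition mderiv_within m n (D : set R) (f : R -> 'M[C]_(m, n)) s A :=
  mcvg (within D s^') (fun r => ((r - s)^-1)%:C *: (f r - f s)) A.

Lemma continuous_withinP (D : set R) (f : R -> R) :
  {within D, continuous f} <->
  (forall s, D s -> f r @[r --> within D (nbhs s)] --> f s).
Proof. exact: subspace_continuousP. Qed.

Lemma mcontinuous_within_entry m n (D : set R) (f : R -> 'M[C]_(m, n)) j k :
  mcontinuous_within D f ->
  {within D, continuous (fun s => complex.Re (f s j k))} /\
  {within D, continuous (fun s => complex.Im (f s j k))}.
Proof.
by move=> cf; split; apply/continuous_withinP => s Ds; have [] := cf s Ds j k.
Qed.

Lemma mcontinuous_withinP m n (D : set R) (f : R -> 'M[C]_(m, n)) :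
  (forall j k, {within D, continuous (fun s => complex.Re (f s j k))} /\
  {within D, continuous (fun s => complex.Im (f s j k))}) ->
  mcontinuous_within D f.
Proof.
move=> cf s Ds j k; have [/continuous_withinP c1 /continuous_withinP c2] := cf j k.
by split; [exact: c1|exact: c2].
Qed.

Lemma mcontinuous_withinW m n (D D' : set R) (f : R -> 'M[C]_(m, n)) :
  D' `<=` D -> mcontinuous_within D f -> mcontinuous_within D' f.
Proof.
move=> D'D cf; apply: mcontinuous_withinP => j k.
have [c1 c2] := mcontinuous_within_entry j k cf.
by split; [exact: continuous_subspaceW c1|exact: continuous_subspaceW c2].
Qed.

Lemma eq_mcvg T (F : set_system T) m n (f g : T -> 'M[C]_(m, n)) A :
  f =1 g -> mcvg F g A -> mcvg F f A.
Proof. by move=> /funext ->. Qed.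

Lemma cvg_subr_within (D : set R) (s : R) :
  (r - s) @[r --> within D s^'] --> (0 : R).
Proof.
rewrite -(subrr s); apply: cvgB; last exact: cvg_cst.
move=> U sU; suff : \forall r \near s, r != s -> D r -> U r by [].
by apply: filterS sU => r.
Qed.

Lemma mderiv_withinW m n (D D' : set R) (f : R -> 'M[C]_(m, n)) s A :
  D' `<=` D -> mderiv_within D f s A -> mderiv_within D' f s A.
Proof.
move=> D'D fA j k; have [f1 f2] := fA j k.
have W : within D' s^' `=>` within D s^'.
  move=> U UD; have {}UD : \forall r \near s, r != s -> D r -> U r := UD.
  suff : \forall r \near s, r != s -> D' r -> U r by [].
  by apply: filterS UD => r DU rs D'r; exact: DU rs (D'D _ D'r).
by split; [exact: cvg_trans (cvg_app _ W) f1|exact: cvg_trans (cvg_app _ W) f2].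
Qed.

(** Write $f(r) = f(s) + (r-s)\,q(r)$ with $q$ the difference quotient, whose limit is finite. *)
Lemma mderiv_mcvg m n (D : set R) (f : R -> 'M[C]_(m, n)) s A :
  mderiv_within D f s A -> mcvg (within D s^') f (f s).
Proof.
move=> fA.
apply: (@eq_mcvg _ _ _ _ _
    (fun r => f s + (r - s)%:C *: (((r - s)^-1)%:C *: (f r - f s)))).
  move=> r; rewrite scalerA -rmorphM /=.
  have [->|rs] := eqVneq r s; first by rewrite !subrr scaler0 addr0.
  by rewrite divff ?subr_eq0// scale1r addrC subrK.
rewrite [X in mcvg _ _ X](_ : _ = f s + 0%:C *: A); last first.
  by rewrite scale0r addr0.
apply: mcvgD; first exact: mcvg_cst.
by apply: mcvgZ => //; exact/ccvg_real/cvg_subr_within.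
Qed.

(** The limit is the value at [s], so the point removed from the neighbourhood can be put back. *)
Lemma cvg_within_dnbhs (D : set R) (f : R -> R) (s : R) :
  f r @[r --> within D s^'] --> f s -> f r @[r --> within D (nbhs s)] --> f s.
Proof.
move=> fs U Us.
have H : \forall r \near s, r != s -> D r -> U (f r) := fs U Us.
suff : \forall r \near s, D r -> U (f r) by [].
apply: filterS H => r H Dr; have [->|rs] := eqVneq r s; last exact: H.
exact: nbhs_singleton.
Qed.

Lemma mderiv_mcontinuous m n (D : set R) (f df : R -> 'M[C]_(m, n)) :
  (forall s, D s -> mderiv_within D f s (df s)) -> mcontinuous_within D f.
Proof.
move=> dfE s Ds j k; have [f1 f2] := mderiv_mcvg (dfE s Ds) j k.
split.
  exact: (@cvg_within_dnbhs D (fun s => complex.Re (f s j k))).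
exact: (@cvg_within_dnbhs D (fun s => complex.Im (f s j k))).
Qed.

(** The quotient splits as $f(r)\,\Delta g + \Delta f\, g(s)$, with the order of the factors
    kept. *)
Lemma mderivM m n p (D : set R) (f : R -> 'M[C]_(m, n)) (g : R -> 'M[C]_(n, p))
    s A B : mderiv_within D f s A -> mderiv_within D g s B ->
  mderiv_within D (fun r => f r *m g r) s (f s *m B + A *m g s).
Proof.
move=> fA gB; apply: (@eq_mcvg _ _ _ _ _ (fun r =>
  f r *m (((r - s)^-1)%:C *: (g r - g s)) + ((r - s)^-1)%:C *: (f r - f s) *m g s)).
  move=> r; rewrite -scalemxAr -scalemxAl -scalerDr mulmxBr mulmxBl.
  by rewrite addrA subrK.
apply: mcvgD; first by apply: mcvgM => //; exact: mderiv_mcvg fA.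
by apply: mcvgM => //; exact: mcvg_cst.
Qed.

Lemma mderiv_cst m n (D : set R) (A : 'M[C]_(m, n)) s :
  mderiv_within D (fun=> A) s 0.
Proof.
apply: (@eq_mcvg _ _ _ _ _ (fun=> 0)); last exact: mcvg_cst.
by move=> r; rewrite subrr scaler0.
Qed.

Lemma op_has_derivative_withinE d (D : set R) (f : R -> 'M[C]_d) s A :
  op_has_derivative_within D f s A <-> mderiv_within D f s A.
Proof.
have E r j k : (((r - s)^-1)%:C *: (f r - f s)) j k =
    ((complex.Re (f r j k) - complex.Re (f s j k)) / (r - s) +i*
    ((complex.Im (f r j k) - complex.Im (f s j k)) / (r - s))).
  rewrite !mxE; case: (f r j k) => x y; case: (f s j k) => z w /=.
  by apply/eqP; rewrite eq_complex /= !mul0r subr0 addr0 ![_^-1 * _]mulrC !eqxx.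
split=> H j k; have [H1 H2] := H j k.
  by split; under eq_fun do rewrite E /=.
split; rewrite /has_derivative_within.
  by move: H1; under eq_fun do rewrite E /=.
by move: H2; under eq_fun do rewrite E /=.
Qed.

(** Caratheodory's criterion: the slope, completed by the value [l] at [s], is continuous there. *)
Lemma has_derivative_within_is_derive (D : set R) (f : R -> R) (s l : R) :
  nbhs s D -> has_derivative_within D f s l -> is_derive s (1 : R) f l.
Proof.
move=> sD fl; apply/is_derive1_caratheodory.
exists (fun z => if z == s then l else (f z - f s) / (z - s)); split.
- move=> z; have [->|zs] := eqVneq z s; first by rewrite !subrr mulr0.
  by rewrite divfK// subr_eq0.
- move=> U; rewrite /= eqxx => Ul.
  have H : \forall r \near s, r != s -> D r -> U ((f r - f s) / (r - s)) := fl U Ul.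
  suff : \forall r \near s, U (if r == s then l else (f r - f s) / (r - s)) by [].
  apply: filterS2 sD H => r Dr H; have [_|rs] := eqVneq r s; last exact: H.
  exact: nbhs_singleton.
- by rewrite eqxx.
Qed.

Lemma is_derive_has_derivative_within (D : set R) (f : R -> R) (s l : R) :
  is_derive s (1 : R) f l -> has_derivative_within D f s l.
Proof.
move=> /is_derive1_caratheodory [g [fE cg <-]] U Us.
suff : \forall r \near s, r != s -> D r -> U ((f r - f s) / (r - s)) by [].
have H : \forall r \near s, U (g r) := cg U Us.
by apply: filterS H => r Ur rs _; rewrite fE mulfK ?subr_eq0.
Qed.

(** * Integrals and the fundamental theorem of calculus *)

Lemma integrable_continuous_within (a b : R) (f : R -> R) :
  {within `[a, b], continuous f} ->
  (@lebesgue_measure R).-integrable `[a, b] (EFin \o f).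
Proof. by apply: continuous_compact_integrable; exact: segment_compact. Qed.

(** At interior points the relative derivative is two-sided; continuity of [F] on the closed
    interval takes care of the endpoints. *)
Lemma FTC_within (a b : R) (F f : R -> R) : a < b ->
  {within `[a, b], continuous F} -> {within `[a, b], continuous f} ->
  (forall s, s \in `]a, b[ -> has_derivative_within `[a, b] F s (f s)) ->
  \int[lebesgue_measure]_(x in `[a, b]) f x = F b - F a.
Proof.
move=> ab cF cf dF.
have dF' s : s \in `]a, b[ -> is_derive s (1 : R) F (f s).
  move=> sab; apply: has_derivative_within_is_derive (dF s sab).
  have : nbhs s [set` `]a, b[] by exact: near_in_itvoo.
  by apply: filterS => x; exact: subset_itv_oo_cc.
rewrite /Rintegral (continuous_FTC2 (F := F) ab cf)//.
  have /(continuous_within_itvP _ ab)[_ Fa Fb] := cF.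
  split => //; by move=> s /dF' [].
by move=> s /dF' dFs; rewrite derive1E derive_val.
Qed.

Lemma op_integral_FTC d (a b : R) (F f : R -> 'M[C]_d) : a < b ->
  mcontinuous_within `[a, b] F -> mcontinuous_within `[a, b] f ->
  (forall s, s \in `]a, b[ -> mderiv_within `[a, b] F s (f s)) ->
  op_integral a b f = F b - F a.
Proof.
move=> ab cF cf dF; apply/matrixP => j k; rewrite !mxE.
have [F1 F2] := mcontinuous_within_entry j k cF.
have [f1 f2] := mcontinuous_within_entry j k cf.
rewrite (FTC_within ab F1 f1); last first.
  by move=> s /dF/op_has_derivative_withinE/(_ j k)[].
rewrite (FTC_within ab F2 f2); last first.
  by move=> s /dF/op_has_derivative_withinE/(_ j k)[].
by case: (F b j k) => ? ?; case: (F a j k) => ? ?.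
Qed.

Lemma op_integralD d (a b : R) (f g : R -> 'M[C]_d) :
  mcontinuous_within `[a, b] f -> mcontinuous_within `[a, b] g ->
  op_integral a b (fun u => f u + g u) = op_integral a b f + op_integral a b g.
Proof.
move=> cf cg; apply/matrixP => j k; rewrite !mxE.
have [f1 f2] := mcontinuous_within_entry j k cf.
have [g1 g2] := mcontinuous_within_entry j k cg.
apply/eqP; rewrite eq_complex /= -!RintegralD//;
  try exact: integrable_continuous_within.
by apply/andP; split; apply/eqP; apply: eq_Rintegral => u _; rewrite mxE ?complex_ReD ?complex_ImD.
Qed.

Lemma eq_op_integral d (a b : R) (f g : R -> 'M[C]_d) :
  (forall u, u \in `[a, b] -> f u = g u) -> op_integral a b f = op_integral a b g.
Proof.
move=> fg; apply/matrixP => j k; rewrite !mxE.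
by congr (_ +i* _); apply: eq_Rintegral => u; rewrite inE => uab; rewrite fg.
Qed.

Lemma op_integral_set1 d (a : R) (f : R -> 'M[C]_d) : op_integral a a f = 0.
Proof. by apply/matrixP => j k; rewrite !mxE set_itv1 !Rintegral_set1. Qed.

Lemma op_integral_continuous d (a b : R) (f : R -> 'M[C]_d) : a <= b ->
  mcontinuous_within `[a, b] f ->
  mcontinuous_within `[a, b] (fun s => op_integral a s f).
Proof.
move=> ab cf; apply: mcontinuous_withinP => j k.
have [f1 f2] := mcontinuous_within_entry j k cf.
split.
  rewrite (_ : (fun s => _) = fun s =>
      \int[lebesgue_measure]_(u in `[a, s]) complex.Re (f u j k)); last first.
    by apply/funext => s; rewrite mxE.
  by apply: (parameterized_integral_continuous ab); exact: integrable_continuous_within.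
rewrite (_ : (fun s => _) = fun s =>
    \int[lebesgue_measure]_(u in `[a, s]) complex.Im (f u j k)); last first.
  by apply/funext => s; rewrite mxE.
by apply: (parameterized_integral_continuous ab); exact: integrable_continuous_within.
Qed.

(** One entry of [op_integral]; complex linearity is proved here and then lifted to matrix
    products. *)
Definition cintegral (a b : R) (f : R -> C) : C :=
  (\int[lebesgue_measure]_(u in `[a, b]) complex.Re (f u)) +i*
  (\int[lebesgue_measure]_(u in `[a, b]) complex.Im (f u)).

Definition ccontinuous_within (D : set R) (f : R -> C) :=
  {within D, continuous (fun s => complex.Re (f s))} /\
  {within D, continuous (fun s => complex.Im (f s))}.

Lemma ccontinuous_withinE (D : set R) (f : R -> C) :
  ccontinuous_within D f <-> forall s, D s -> ccvg (within D (nbhs s)) f (f s).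
Proof.
split=> [[/continuous_withinP c1 /continuous_withinP c2] s Ds|cf].
  by split; [exact: c1|exact: c2].
by split; apply/continuous_withinP => s Ds; have [] := cf s Ds.
Qed.

Lemma cintegralD (a b : R) (f g : R -> C) :
  ccontinuous_within `[a, b] f -> ccontinuous_within `[a, b] g ->
  cintegral a b (fun u => f u + g u) = cintegral a b f + cintegral a b g.
Proof.
move=> [f1 f2] [g1 g2]; apply/eqP; rewrite eq_complex /= -!RintegralD//;
  try exact: integrable_continuous_within.
by apply/andP; split; apply/eqP; apply: eq_Rintegral => u _; rewrite ?complex_ReD ?complex_ImD.
Qed.

Lemma cintegralZ (a b : R) (c : C) (f : R -> C) :
  ccontinuous_within `[a, b] f ->
  cintegral a b (fun u => c * f u) = c * cintegral a b f.
Proof.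
move=> [f1 f2]; have if1 := integrable_continuous_within f1.
have if2 := integrable_continuous_within f2.
have Z (x : R) (g : R -> R) : (@lebesgue_measure R).-integrable `[a, b] (EFin \o g) ->
    (@lebesgue_measure R).-integrable `[a, b] (EFin \o (fun u => x * g u)).
  move=> ig; rewrite (_ : _ \o _ = (fun u => x%:E * (EFin \o g) u)%E).
    exact: integrableZl.
  by apply/funext => u; rewrite /= EFinM.
apply/eqP; rewrite eq_complex complex_ReM complex_ImM /= -!RintegralZl//.
rewrite -RintegralB//; try exact: Z.
rewrite -RintegralD//; try exact: Z.
by apply/andP; split; apply/eqP; apply: eq_Rintegral => u _; rewrite ?complex_ReM ?complex_ImM.
Qed.

Lemma cintegral_sum (I : Type) (r : seq I) (a b : R) (f : I -> R -> C) :
  (forall i, ccontinuous_within `[a, b] (f i)) ->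
  cintegral a b (fun u => \sum_(i <- r) f i u) =
  \sum_(i <- r) cintegral a b (f i).
Proof.
move=> cf; elim: r => [|i s IH].
  rewrite big_nil; under eq_fun do rewrite big_nil.
  apply/eqP; rewrite eq_complex /=.
  by apply/andP; split; apply/eqP; rewrite /Rintegral integral0.
rewrite big_cons; under eq_fun do rewrite big_cons.
rewrite cintegralD// ?IH//; apply/ccontinuous_withinE => u abu.
apply: ccvg_sum => j; exact: (ccontinuous_withinE _ _).1 (cf j) u abu.
Qed.

Lemma op_integralE d (a b : R) (f : R -> 'M[C]_d) j k :
  op_integral a b f j k = cintegral a b (fun u => f u j k).
Proof. by rewrite mxE. Qed.

Lemma mcontinuous_within_ccontinuous m n (D : set R) (f : R -> 'M[C]_(m, n)) j k :
  mcontinuous_within D f -> ccontinuous_within D (fun u => f u j k).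
Proof. exact: mcontinuous_within_entry. Qed.

Lemma mcontinuous_cst m n (D : set R) (A : 'M[C]_(m, n)) :
  mcontinuous_within D (fun=> A).
Proof. by move=> s Ds; exact: mcvg_cst. Qed.

Lemma mcontinuousM m n p (D : set R) (f : R -> 'M[C]_(m, n)) (g : R -> 'M[C]_(n, p)) :
  mcontinuous_within D f -> mcontinuous_within D g ->
  mcontinuous_within D (fun u => f u *m g u).
Proof. by move=> cf cg s Ds; apply: mcvgM; [exact: cf|exact: cg]. Qed.

Lemma op_integral_mull d (a b : R) (A : 'M[C]_d) (f : R -> 'M[C]_d) :
  mcontinuous_within `[a, b] f ->
  op_integral a b (fun u => A *m f u) = A *m op_integral a b f.
Proof.
move=> cf; apply/matrixP => j k; rewrite op_integralE [RHS]mxE.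
under eq_fun do rewrite mxE.
have cfe l := mcontinuous_within_ccontinuous l k cf.
rewrite cintegral_sum.
  by apply: eq_bigr => l _; rewrite cintegralZ// op_integralE.
move=> l; apply/ccontinuous_withinE => u abu; apply: ccvgM; first exact: ccvg_cst.
exact: (ccontinuous_withinE _ _).1 (cfe l) u abu.
Qed.

Lemma op_integral_mulr d (a b : R) (A : 'M[C]_d) (f : R -> 'M[C]_d) :
  mcontinuous_within `[a, b] f ->
  op_integral a b (fun u => f u *m A) = op_integral a b f *m A.
Proof.
move=> cf; apply/matrixP => j k; rewrite op_integralE [RHS]mxE.
under eq_fun do rewrite mxE.
have cfe l := mcontinuous_within_ccontinuous j l cf.
rewrite (_ : (fun _ => _) = fun u => \sum_l A l k * f u j l); last first.
  by apply/funext => u; apply: eq_bigr => l _; rewrite mulrC.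
rewrite cintegral_sum.
  by apply: eq_bigr => l _; rewrite cintegralZ// op_integralE mulrC.
move=> l; apply/ccontinuous_withinE => u abu; apply: ccvgM; first exact: ccvg_cst.
exact: (ccontinuous_withinE _ _).1 (cfe l) u abu.
Qed.

Lemma Re_tr_op_integral d (a b : R) (f : R -> 'M[C]_d) :
  mcontinuous_within `[a, b] f ->
  complex.Re (\tr (op_integral a b f)) =
  \int[lebesgue_measure]_(u in `[a, b]) complex.Re (\tr (f u)).
Proof.
move=> cf; transitivity (complex.Re (cintegral a b (fun u => \tr (f u)))) => //.
rewrite /mxtrace cintegral_sum.
  by congr (complex.Re _); apply: eq_bigr => l _; rewrite op_integralE.
by move=> l; exact: mcontinuous_within_ccontinuous.
Qed.

(** For a contraction $B$, the functional $\mathrm{Re}\,\mathrm{tr}(B\,\cdot)$ passes under the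
    integral and is at most $g$ there. The function integrated is the continuous majorant [g], not
    the trace norm of [f]. *)
Lemma trace_norm_op_integral_le d (a b : R) (f : R -> 'M[C]_d) (g : R -> R) :
  mcontinuous_within `[a, b] f -> {within `[a, b], continuous g} ->
  (forall u, u \in `[a, b] -> trace_norm (f u) <= g u) ->
  trace_norm (op_integral a b f) <= \int[lebesgue_measure]_(u in `[a, b]) g u.
Proof.
move=> cf cg fg; apply: trace_norm_le => B B1.
have cBf : mcontinuous_within `[a, b] (fun u => B *m f u).
  by apply: mcontinuousM => //; exact: mcontinuous_cst.
rewrite -op_integral_mull// Re_tr_op_integral//; apply: le_Rintegral => //.
- apply: integrable_continuous_within; apply/continuous_withinP => s Ds.
  by have [] := ccvg_sum (index_enum _) (fun i => cBf s Ds i i).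
- exact: integrable_continuous_within.
by move=> u uab; apply: le_trans (fg u uab); rewrite -[leRHS]mul1r; exact: Re_tr_mul_le.
Qed.

Lemma Rintegral_pow (s : R) n (c : R) : 0 <= s ->
  \int[lebesgue_measure]_(u in `[0, s]) (c * u ^+ n / n`!%:R) =
  c * s ^+ n.+1 / n.+1`!%:R.
Proof.
(* The fundamental theorem is stated for nondegenerate intervals, so $s = 0$ is treated apart. *)
rewrite le_eqVlt => /predU1P[<-|s0].
  by rewrite set_itv1 Rintegral_set1 expr0n mulr0 mul0r.
have dF u : is_derive u (1 : R) (fun u : R => c * u ^+ n.+1 / n.+1`!%:R)
    (c * u ^+ n / n`!%:R).
  rewrite (_ : (fun _ => _) = (c / n.+1`!%:R) \*: ((@id R) ^+ n.+1)); last first.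
    by apply/funext => v; rewrite !fctE /= -[RHS]/(_ * _) mulrAC.
  apply: is_derive_eq; rewrite /= -![_ *: _]/(_ * _) mulr1 factS natrM.
  have n0 : (n.+1%:R : R) != 0 by rewrite pnatr_eq0.
  have f0 : (n`!%:R : R) != 0 by rewrite pnatr_eq0 -lt0n fact_gt0.
  by move: (n.+1%:R : R) n0 => x x0; field; rewrite ?x0 ?f0.
have cts (m : nat) :
    {within `[0, s], continuous (fun u : R => c * u ^+ m / m`!%:R)}.
  apply: continuous_subspaceT => u; apply: cvgM; last exact: cvg_cst.
  by apply: cvgM; [exact: cvg_cst|exact: exprn_continuous].
rewrite (FTC_within s0 (cts n.+1) (cts n)).
  by rewrite expr0n mulr0 mul0r subr0.
by move=> u _; exact: is_derive_has_derivative_within.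
Qed.

End MatrixLimits.

Arguments ccvg {R T} F f l.
Arguments mcvg {R T} F {m n} f A.

(** * Unitary evolution *)

(** This is $e^{-ix}$. *)
Definition cexpNi (R : realType) (x : R) : R[i] := Complex (cos x) (- sin x).

(** This is $e^{-iHs}$ for $H = V^\dagger \mathrm{diag}(h) V$. *)
HB.lock Definition evol (R : realType) (d : nat) (V : 'M[R[i]]_d)
    (h : 'I_d -> R) (s : R) : 'M[R[i]]_d :=
  V^t* *m diag_mx (\row_j cexpNi (s * h j)) *m V.

Section Evolution.
Context {R : realType}.
Local Notation C := R[i].

Lemma cexpNiD (x y : R) : cexpNi (x + y) = cexpNi x * cexpNi y.
Proof.
apply/eqP; rewrite eq_complex complex_ReM complex_ImM /= cosD sinD.
by apply/andP; split; apply/eqP; ring.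
Qed.

Lemma cexpNi0 : cexpNi (0 : R) = 1.
Proof. by rewrite /cexpNi cos0 sin0 oppr0. Qed.

Lemma conj_cexpNi (x : R) : (cexpNi x)^* = cexpNi (- x).
Proof. by rewrite /cexpNi cosN sinN. Qed.

(** Euler's formula term by term: splitting [m] by parity, even powers of $-i$ are real and give the
    cosine series, odd ones are imaginary and give the sine series. *)
Lemma expNi_term (s w : R) m :
  (s ^+ m / m`!%:R)%:C * (- 'i * w%:C) ^+ m =
  Complex (cos_coeff (s * w) m) (- sin_coeff (s * w) m) :> C.
Proof.
rewrite exprMn -complexiE.
have E k : (- 'i%C) ^+ k.*2 = ((-1) ^+ k)%:C :> C.
  by rewrite -mul2n exprM sqrrN sqr_i rmorphXn rmorphN1.
rewrite /cos_coeff /sin_coeff /= -rmorphXn /= -(odd_double_half m).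
move: (m./2) => k; case: (odd m); rewrite ?add1n ?add0n ?exprS E /= odd_double
  ?uphalf_double ?doubleK; apply/eqP;
  rewrite eq_complex !complex_ReM !complex_ImM /= exprMn;
  by apply/andP; split; apply/eqP; rewrite -?exprnP; ring.
Qed.

Lemma ccvg_expNi_series (s w : R) :
  ccvg \oo (fun n => \sum_(m < n) (s ^+ m / m`!%:R)%:C * (- 'i * w%:C) ^+ m)
    (cexpNi (s * w)).
Proof.
have E n : \sum_(m < n) (s ^+ m / m`!%:R)%:C * (- 'i * w%:C) ^+ m =
    Complex (series (cos_coeff (s * w)) n) (- series (sin_coeff (s * w)) n).
  rewrite /series /= !big_mkord; elim: n => [|n IH].
    by rewrite !big_ord0 oppr0.
  by rewrite !big_ord_recr /= IH expNi_term opprD.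
split.
  rewrite (_ : (fun _ => _) = series (cos_coeff (s * w))); last first.
    by apply/funext => n; rewrite E.
  by rewrite /= unlock; exact: is_cvg_series_cos_coeff.
rewrite (_ : (fun _ => _) = fun n => - series (sin_coeff (s * w)) n); last first.
  by apply/funext => n; rewrite E.
by apply: cvgN; rewrite /= unlock; exact: is_cvg_series_sin_coeff.
Qed.

Lemma has_derivative_within_scale (D : set R) (f : R -> R) (df h s : R) :
  is_derive (s * h) (1 : R) f df ->
  has_derivative_within D (fun r => f (r * h)) s (h * df).
Proof.
move=> fdf; apply: is_derive_has_derivative_within.
have -> : (fun r => f (r * h)) = f \o (fun r => r * h) by [].
rewrite mulrC; apply: is_derive1_comp.
rewrite (_ : (fun r => r * h) = h \*: (@id R)); last first.
  by apply/funext => r; rewrite /= mulrC.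
by apply: is_derive_eq; rewrite /= -[LHS]/(_ * _) mulr1.
Qed.

Lemma has_derivative_within_cst (D : set R) (c s : R) :
  has_derivative_within D (fun=> c) s 0.
Proof. exact: is_derive_has_derivative_within. Qed.

Lemma mderiv_cexpNi d (D : set R) (h : 'I_d -> R) s :
  mderiv_within D (fun r => diag_mx (\row_j cexpNi (r * h j))) s
    (- 'i *: (diag_mx (\row_j (h j)%:C) *m diag_mx (\row_j cexpNi (s * h j)))).
Proof.
apply/op_has_derivative_withinE => j k.
have E r : diag_mx (\row_j cexpNi (r * h j)) j k =
    (cos (r * h k) *+ (j == k)) +i* (- sin (r * h k) *+ (j == k)).
  by rewrite !mxE; case: eqP => // ->.
have E' : (- 'i *: (diag_mx (\row_j (h j)%:C) *m
      diag_mx (\row_j cexpNi (s * h j)))) j k =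
    (h k * - sin (s * h k) *+ (j == k)) +i* (h k * - cos (s * h k) *+ (j == k)).
  rewrite mulmx_diag !mxE -complexiE; case: eqP => [->|_]; last by rewrite mulr0.
  apply/eqP; rewrite eq_complex /= !mulr1n; apply/andP.
  by split; apply/eqP; ring.
rewrite E' /=; split.
  rewrite (_ : (fun _ => _) = fun r => cos (r * h k) *+ (j == k)); last first.
    by apply/funext => r; rewrite E.
  have [_|_] := eqVneq j k; last exact: has_derivative_within_cst.
  exact: has_derivative_within_scale.
rewrite (_ : (fun _ => _) = fun r => - sin (r * h k) *+ (j == k)); last first.
  by apply/funext => r; rewrite E.
have [_|_] := eqVneq j k; last exact: has_derivative_within_cst.
exact: (@has_derivative_within_scale _ (fun x => - sin x)).
Qed.

(** * Evolution under a Hermitian operator in its eigenbasis *)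

Section Hamiltonian.
Context {d : nat} {V : 'M[C]_d} (V_unitary : V \is unitarymx) {h : 'I_d -> R}.

(** Passage from the eigenbasis, where $H$ is diagonal, back to the original basis; for unitary [V]
    it is an algebra isomorphism. *)
Definition eigen_conj (X : 'M[C]_d) := V^t* *m X *m V.

Let VV : V *m V^t* = 1%:M.
Proof. exact/unitarymxP. Qed.

Let VV' : V^t* *m V = 1%:M.
Proof. exact: mulmx1C VV. Qed.

Lemma eigen_conjM X Y : eigen_conj X *m eigen_conj Y = eigen_conj (X *m Y).
Proof.
by rewrite /eigen_conj !mulmxA -[_ *m V *m V^t*]mulmxA VV mulmx1.
Qed.

Lemma eigen_conj1 : eigen_conj 1%:M = 1%:M.
Proof. by rewrite /eigen_conj mulmx1 VV'. Qed.

Lemma eigen_conjK A : eigen_conj (V *m A *m V^t*) = A.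
Proof. by rewrite /eigen_conj !mulmxA VV' mul1mx -mulmxA VV' mulmx1. Qed.

Lemma eigen_conjB X Y : eigen_conj X - eigen_conj Y = eigen_conj (X - Y).
Proof. by rewrite /eigen_conj mulmxBr mulmxBl. Qed.

Lemma eigen_conjZ a X : a *: eigen_conj X = eigen_conj (a *: X).
Proof. by rewrite /eigen_conj -scalemxAr -scalemxAl. Qed.

Lemma eigen_conj_sum (I : Type) (r : seq I) (F : I -> 'M[C]_d) :
  \sum_(i <- r) eigen_conj (F i) = eigen_conj (\sum_(i <- r) F i).
Proof. by rewrite /eigen_conj mulmx_sumr mulmx_suml. Qed.

Local Notation evol := (evol V h).

Lemma evolE s : evol s = eigen_conj (diag_mx (\row_j cexpNi (s * h j))).
Proof. by rewrite evol.unlock. Qed.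

Lemma evolD s u : evol (s + u) = evol s *m evol u.
Proof.
rewrite !evolE eigen_conjM mulmx_diag; congr (eigen_conj (diag_mx _)).
by apply/rowP => j; rewrite !mxE mulrDl cexpNiD.
Qed.

Lemma evol0 : evol 0 = 1%:M.
Proof.
rewrite -eigen_conj1 evolE -diag_const_mx; congr (eigen_conj (diag_mx _)).
by apply/rowP => j; rewrite !mxE mul0r cexpNi0.
Qed.

Lemma evolVr s : evol s *m evol (- s) = 1%:M.
Proof. by rewrite -evolD subrr evol0. Qed.

Lemma evol_adj s : (evol s)^t* = evol (- s).
Proof.
rewrite !evolE /eigen_conj !trmx_mul !map_mxM /= trmxCK mulmxA tr_diag_mx map_diag_mx.
have -> // : map_mx Num.conj (\row_j cexpNi (s * h j)) = \row_j cexpNi (- s * h j).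
by apply/rowP => j; rewrite !mxE mulNr -conj_cexpNi.
Qed.

Lemma bounded_evol s : bounded_mx 1 (evol s).
Proof. by apply: unitarymx_bounded; apply/unitarymxP; rewrite evol_adj evolVr. Qed.

Context {H : 'M[C]_d} (hamiltonianE : H = eigen_conj (diag_mx (\row_j (h j)%:C))).

Lemma hamiltonian_evolC s : H *m evol s = evol s *m H.
Proof.
rewrite [in LHS]hamiltonianE [in RHS]hamiltonianE !evolE !eigen_conjM !mulmx_diag.
by congr (eigen_conj (diag_mx _)); apply/rowP => j; rewrite !mxE mulrC.
Qed.

Lemma mderiv_evol (D : set R) s :
  mderiv_within D evol s (- 'i *: (H *m evol s)).
Proof.
have -> : evol = fun s => eigen_conj (diag_mx (\row_j cexpNi (s * h j))).
  by apply/funext => r; rewrite evolE.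
have := mderivM (mderivM (mderiv_cst D (V^t*) s) (@mderiv_cexpNi _ D h s))
  (mderiv_cst D V s).
rewrite mulmx0 mul0mx add0r addr0 -scalemxAr -scalemxAl -/(eigen_conj _).
by rewrite -eigen_conjM -hamiltonianE.
Qed.

Lemma mcontinuous_evol (D : set R) : mcontinuous_within D evol.
Proof. by apply: mderiv_mcontinuous => s _; exact: mderiv_evol. Qed.

(** In the eigenbasis the commutator multiplies entry $(j,k)$ by $-i(h_j - h_k)$, so its powers act
    entry by entry. *)
Lemma iter_hamiltonian m A (B := V *m A *m V^t*) :
  iter m (hamiltonian_part H) A =
  eigen_conj (\matrix_(j, k) ((- 'i * (h j - h k)%:C) ^+ m * B j k)).
Proof.
elim: m => [|m IH].
  rewrite /= -[LHS]eigen_conjK -/B; congr (eigen_conj _).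
  by apply/matrixP => j k; rewrite !mxE expr0 mul1r.
rewrite iterS IH /hamiltonian_part {1 2}hamiltonianE !eigen_conjM eigen_conjB.
rewrite eigen_conjZ; congr (eigen_conj _); apply/matrixP => j k.
rewrite mul_diag_mx mul_mx_diag !mxE exprS rmorphB /=; ring.
Qed.

(** The scalar series at entry $(j,k)$ sums to $e^{-is(h_j-h_k)} = e^{-ish_j}e^{ish_k}$; the two
    factors are the left and right diagonal matrices. *)
Lemma superop_exp_evol s A :
  superop_exp s (hamiltonian_part H) A = evol s *m A *m evol (- s).
Proof.
apply: op_lim_mcvg; set B := V *m A *m V^t*.
have -> : evol s *m A *m evol (- s) = eigen_conj (\matrix_(j, k)
    (cexpNi (s * (h j - h k)) * B j k)).
  rewrite -{1}[A]eigen_conjK -/B !evolE !eigen_conjM; congr (eigen_conj _).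
  apply/matrixP => j k; rewrite mul_diag_mx mul_mx_diag !mxE.
  by rewrite mulrBr cexpNiD mulNr mulrAC.
apply: (@eq_mcvg _ _ _ _ _ _ (fun n => eigen_conj (\matrix_(j, k)
    ((\sum_(m < n) (s ^+ m / m`!%:R)%:C *
      (- 'i * (h j - h k)%:C) ^+ m) * B j k)))).
  move=> n; under eq_bigr do rewrite iter_hamiltonian eigen_conjZ.
  rewrite eigen_conj_sum; congr (eigen_conj _); apply/matrixP => j k.
  rewrite summxE mxE mulr_suml; apply: eq_bigr => m _.
  by rewrite !mxE mulrA.
apply: mcvgM; last exact: mcvg_cst.
apply: mcvgM; first exact: mcvg_cst.
move=> j k; rewrite mxE; under eq_fun do rewrite mxE.
by apply: ccvgM; [exact: ccvg_expNi_series|exact: ccvg_cst].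
Qed.

Lemma trace_norm_evol s A :
  trace_norm (evol s *m A *m evol (- s)) <= trace_norm A.
Proof.
apply: le_trans (trace_norm_mulr _ ler01 (bounded_evol _)) _; rewrite mul1r.
by apply: le_trans (trace_norm_mull _ ler01 (bounded_evol _)) _; rewrite mul1r.
Qed.

End Hamiltonian.

(** Spectral theorem; the eigenvalues of a Hermitian matrix are real, so taking their real parts
    changes nothing. *)
Lemma hermsym_eigen_conj d (H : 'M[C]_d) : H \is hermsymmx ->
  exists V, V \is unitarymx /\ exists h : 'I_d -> R,
    H = @eigen_conj _ V (diag_mx (\row_j (h j)%:C)).
Proof.
move=> H_herm; exists (spectralmx H); have Vu := spectral_unitarymx H.
split=> //; exists (fun j => complex.Re (spectral_diag H 0 j)).
rewrite -[LHS](eigen_conjK Vu) (hermsym_spectralE H_herm).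
congr (eigen_conj (diag_mx _)).
apply/rowP => j; rewrite mxE RRe_real//.
exact: (mxOverP (hermitian_spectral_diag_real H_herm)).
Qed.

End Evolution.

Arguments eigen_conj {R d} V X.

(** * Duhamel expansion *)

Section Perturbation.
Context {R : realType}.
Local Notation C := R[i].

Lemma eq_continuous_within (D : set R) (f g : R -> R) :
  (forall s, D s -> f s = g s) -> {within D, continuous g} ->
  {within D, continuous f}.
Proof.
move=> fg; apply: (@subspace_eq_continuous _ D _ g f) => s.
by rewrite inE => Ds; rewrite fg.
Qed.

Lemma eq_mcontinuous m n (D : set R) (f g : R -> 'M[C]_(m, n)) :
  (forall s, D s -> f s = g s) -> mcontinuous_within D g ->
  mcontinuous_within D f.
Proof.
move=> fg cg; apply: mcontinuous_withinP => j k.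
have [g1 g2] := mcontinuous_within_entry j k cg.
by split; [apply: eq_continuous_within g1|apply: eq_continuous_within g2] => s Ds;
  rewrite fg.
Qed.

Lemma mcontinuousD m n (D : set R) (f g : R -> 'M[C]_(m, n)) :
  mcontinuous_within D f -> mcontinuous_within D g ->
  mcontinuous_within D (fun u => f u + g u).
Proof. by move=> cf cg s Ds; apply: mcvgD; [exact: cf|exact: cg]. Qed.

Lemma mcontinuousB m n (D : set R) (f g : R -> 'M[C]_(m, n)) :
  mcontinuous_within D f -> mcontinuous_within D g ->
  mcontinuous_within D (fun u => f u - g u).
Proof. by move=> cf cg s Ds; apply: mcvgB; [exact: cf|exact: cg]. Qed.

Lemma mcontinuous_dissipator d N (D : set R) (L : 'I_N -> 'M[C]_d)
    (gamma : 'I_N -> R -> R) (f : R -> 'M[C]_d) :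
  (forall i, {within D, continuous (gamma i)}) -> mcontinuous_within D f ->
  mcontinuous_within D (fun u => dissipator L gamma u (f u)).
Proof.
move=> cg cf s Ds; apply: mcvg_sum => i; apply: mcvgZ.
  by apply: ccvg_real; have /continuous_withinP := cg i; exact.
have fs := cf s Ds.
have cst A : mcvg (within D (nbhs s)) (fun=> A : 'M[C]_d) A by exact: mcvg_cst.
apply: mcvgB; first exact: (mcvgM (mcvgM (cst _) fs) (cst _)).
apply: mcvgZ; first exact: ccvg_cst.
exact: (mcvgD (mcvgM (cst _) fs) (mcvgM fs (cst _))).
Qed.

Lemma dissipatorD d N (L : 'I_N -> 'M[C]_d) (gamma : 'I_N -> R -> R) u
    (A B : 'M[C]_d) :
  dissipator L gamma u (A + B) = dissipator L gamma u A + dissipator L gamma u B.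
Proof.
rewrite /dissipator -big_split; apply: eq_bigr => i _ /=.
rewrite -scalerDr; congr (_ *: _); set X := L i.
rewrite (mulmxDr X A B) (mulmxDl (X *m A)) (mulmxDr (X^t* *m X) A B) (mulmxDl A B).
by rewrite (addrACA (X^t* *m X *m A)) scalerDr opprD addrACA.
Qed.

(** Cancellation behind the interaction picture: with $P = e^{iHs}$, $Q = e^{-iHs}$, $K = H$ and $a
    = i$, the Hamiltonian terms in the derivative of $PXQ$ cancel, leaving the dissipative term
    [Z]. *)
Lemma rotation_cancel (F : fieldType) d (a : F) (P Q X K Z : 'M[F]_d) :
  P *m X *m (- a *: (K *m Q)) + (P *m (- a *: (K *m X - X *m K) + Z) +
    a *: (P *m K) *m X) *m Q = P *m Z *m Q.
Proof.
rewrite !(mulmxDl, mulmxDr, mulmxBr, mulmxBl, scalerBr) ?mulmxN ?mulNmx.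
rewrite -!(scalemxAr, scalemxAl) !mulmxA !scaleNr ?opprK.
move: (a *: (P *m X *m K *m Q)) (a *: (P *m K *m X *m Q)) (P *m Z *m Q) => x y z.
by rewrite [- y + x]addrC -!addrA addKr [z + y]addrC addKr.
Qed.

Lemma rotation_expand (F : fieldType) d (P1 P2 Q1 Q2 X : 'M[F]_d) :
  P1 *m Q1 *m X *m (P2 *m Q2) = P1 *m (Q1 *m X *m P2) *m Q2.
Proof. by rewrite !mulmxA. Qed.

(** Backward evolution is forward evolution under $-H$, so continuity and derivative results for
    [evol] carry over. *)
Lemma evolN_opp d (V : 'M[C]_d) h s : evol V h (- s) = evol V (fun j => - h j) s.
Proof.
rewrite !evolE; have -> // : \row_j cexpNi (- s * h j) = \row_j cexpNi (s * - h j).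
by apply/rowP => j; rewrite !mxE mulNr mulrN.
Qed.

(** * The Duhamel integral operator *)

Section Fixed.
Context {d N : nat} {t : R} {H : 'M[C]_d} {L : 'I_N -> 'M[C]_d}
  {gamma : 'I_N -> R -> R} (t_gt0 : 0 < t)
  (gamma_cont : forall i, {within `[0, t], continuous (gamma i)}).
Context {V : 'M[C]_d} (Vu : V \is unitarymx) {h : 'I_d -> R}
  (HE : H = eigen_conj V (diag_mx (\row_j (h j)%:C))).

Local Notation E := (evol V h).
Local Notation diss := (dissipator L gamma).
Implicit Types f g : R -> 'M[C]_d.

(** The integral operator that takes each series term to the next, and each truncation error to the
    next. *)
Definition duhamel f (s : R) : 'M[C]_d := op_integral 0 s (fun u =>
  superop_exp (s - u) (hamiltonian_part H) (diss u (f u))).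

Lemma mcontinuous_evolN (D : set R) : mcontinuous_within D (fun u => E (- u)).
Proof.
rewrite (_ : (fun _ => _) = evol V (fun j => - h j)); last first.
  by apply/funext => u; rewrite evolN_opp.
exact: mcontinuous_evol Vu _ _ erefl _.
Qed.

Lemma mcontinuous_rotated f : mcontinuous_within `[0, t] f ->
  mcontinuous_within `[0, t] (fun u => E (- u) *m diss u (f u) *m E u).
Proof.
move=> cf; apply: mcontinuousM; last exact: (mcontinuous_evol Vu HE).
apply: mcontinuousM; first exact: mcontinuous_evolN.
exact: mcontinuous_dissipator.
Qed.

Lemma subset_itv0 (s : R) : s \in `[0, t] -> `[0, s] `<=` (`[0, t] : set R).
Proof.
rewrite in_itv /= => /andP[_ st] u /=; rewrite !in_itv /= => /andP[-> us].
exact: le_trans us st.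
Qed.

(** The group law splits $e^{\mp iH(s-u)}$ into factors in $s$, which leave the integral, and
    factors in $u$. The integrand is then independent of $s$, which gives continuity in $s$ and
    access to the fundamental theorem. *)
Lemma duhamelE f s : s \in `[0, t] -> mcontinuous_within `[0, t] f ->
  duhamel f s =
  E s *m op_integral 0 s (fun u => E (- u) *m diss u (f u) *m E u) *m E (- s).
Proof.
move=> st cf; have := mcontinuous_withinW (subset_itv0 st) (mcontinuous_rotated cf).
move=> cr; rewrite -op_integral_mull// -op_integral_mulr; last first.
  by apply: mcontinuousM => //; exact: mcontinuous_cst.
apply: eq_op_integral => u _; rewrite (superop_exp_evol Vu HE).
by rewrite opprB !(evolD Vu) rotation_expand.
Qed.

Lemma mcontinuous_duhamel f : mcontinuous_within `[0, t] f ->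
  mcontinuous_within `[0, t] (duhamel f).
Proof.
move=> cf; apply: (eq_mcontinuous (fun s st => duhamelE st cf)).
apply: mcontinuousM; last exact: mcontinuous_evolN.
apply: mcontinuousM; first exact: (mcontinuous_evol Vu HE).
by apply: op_integral_continuous (ltW t_gt0) _; exact: mcontinuous_rotated.
Qed.

Lemma duhamelD f g s : s \in `[0, t] ->
  mcontinuous_within `[0, t] f -> mcontinuous_within `[0, t] g ->
  duhamel (fun u => f u + g u) s = duhamel f s + duhamel g s.
Proof.
move=> st cf cg; rewrite !duhamelE//; last exact: mcontinuousD.
rewrite -mulmxDl -mulmxDr -op_integralD; last 2 first.
- exact: mcontinuous_withinW (subset_itv0 st) (mcontinuous_rotated cf).
- exact: mcontinuous_withinW (subset_itv0 st) (mcontinuous_rotated cg).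
congr (_ *m _ *m _); apply: eq_op_integral => u _.
by rewrite -mulmxDl -mulmxDr -dissipatorD.
Qed.

Lemma trace_norm_duhamel f (g : R -> R) s : s \in `[0, t] ->
  mcontinuous_within `[0, t] f -> {within `[0, t], continuous g} ->
  (forall u, u \in `[0, t] -> trace_norm (diss u (f u)) <= g u) ->
  trace_norm (duhamel f s) <= \int[lebesgue_measure]_(u in `[0, s]) g u.
Proof.
move=> st cf cg fg; rewrite duhamelE//.
apply: le_trans (trace_norm_evol Vu _ _) _.
have s0t := subset_itv0 st; apply: trace_norm_op_integral_le.
- exact: mcontinuous_withinW s0t (mcontinuous_rotated cf).
- exact: continuous_subspaceW s0t cg.
move=> u us; apply: le_trans (fg u (s0t u us)).
by have := trace_norm_evol (h := h) Vu (- u) (diss u (f u)); rewrite opprK.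
Qed.

Lemma trace_norm_duhamel_pow f (G c : R) n s : s \in `[0, t] ->
  mcontinuous_within `[0, t] f ->
  (forall u A, u \in `[0, t] -> trace_norm (diss u A) <= G * trace_norm A) ->
  0 <= G -> (forall u, u \in `[0, t] -> trace_norm (f u) <= c * u ^+ n / n`!%:R) ->
  trace_norm (duhamel f s) <= G * c * s ^+ n.+1 / n.+1`!%:R.
Proof.
move=> st cf dG G0 fc; rewrite -Rintegral_pow; last by move: st; rewrite in_itv => /andP[].
apply: trace_norm_duhamel => //.
  apply: continuous_subspaceT => u; apply: cvgM; last exact: cvg_cst.
  by apply: cvgM; [exact: cvg_cst|exact: exprn_continuous].
move=> u ut; apply: le_trans (dG u _ ut) _; rewrite -!mulrA ler_wpM2l//.
by rewrite mulrA; exact: fc.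
Qed.

(** * The truncated series and its recursion *)

Lemma mcontinuous_series_term rho0 n :
  mcontinuous_within `[0, t] (series_term H L gamma rho0 n).
Proof.
elim: n => [|n IH]; last exact: mcontinuous_duhamel.
apply: (@eq_mcontinuous _ _ _ _ (fun s => E s *m rho0 *m E (- s))).
  by move=> s _ /=; rewrite (superop_exp_evol Vu HE).
apply: mcontinuousM; last exact: mcontinuous_evolN.
apply: mcontinuousM; first exact: (mcontinuous_evol Vu HE).
exact: mcontinuous_cst.
Qed.

Lemma mcontinuous_truncated rho0 n :
  mcontinuous_within `[0, t] (truncated_series H L gamma rho0 n).
Proof.
by move=> s st; apply: mcvg_sum => i; exact: mcontinuous_series_term.
Qed.

Lemma truncated_series0 rho0 s :
  truncated_series H L gamma rho0 0 s = E s *m rho0 *m E (- s).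
Proof. by rewrite /truncated_series big_ord1 /= (superop_exp_evol Vu HE). Qed.

Lemma truncated_seriesSr rho0 n s :
  truncated_series H L gamma rho0 n.+1 s =
  truncated_series H L gamma rho0 n s + series_term H L gamma rho0 n.+1 s.
Proof. by rewrite /truncated_series big_ord_recr. Qed.

Lemma series_termS rho0 n s : series_term H L gamma rho0 n.+1 s =
  duhamel (series_term H L gamma rho0 n) s.
Proof. by []. Qed.

(** Additivity of [duhamel] turns the sum of series terms into the integral recursion for the
    truncations. *)
Lemma truncated_seriesS rho0 n s : s \in `[0, t] ->
  truncated_series H L gamma rho0 n.+1 s =
  truncated_series H L gamma rho0 0 s +
  duhamel (truncated_series H L gamma rho0 n) s.
Proof.
move=> st; elim: n => [|n IH]; rewrite truncated_seriesSr.
  have -> // : truncated_series H L gamma rho0 0 = series_term H L gamma rho0 0.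
  by apply/funext => u; rewrite /truncated_series big_ord1.
rewrite IH -addrA; have cT := mcontinuous_truncated rho0 n.
rewrite (series_termS rho0 n.+1 s).
rewrite -(duhamelD st cT (mcontinuous_series_term rho0 n.+1)).
have E' : (fun u => truncated_series H L gamma rho0 n u +
    series_term H L gamma rho0 n.+1 u) = truncated_series H L gamma rho0 n.+1.
  by apply/funext => u; exact/esym/truncated_seriesSr.
exact: (congr1 (fun f => truncated_series H L gamma rho0 0 s + duhamel f s) E').
Qed.

(** * The solution and its truncation errors *)

Section Solution.
Context {rho : R -> 'M[C]_d} (rho_sol : forall s, s \in `[0, t] ->
  mderiv_within `[0, t] rho s (hamiltonian_part H (rho s) + diss s (rho s))).

Lemma mcontinuous_solution : mcontinuous_within `[0, t] rho.
Proof. exact: mderiv_mcontinuous rho_sol. Qed.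

(** In the interaction picture the commutator with $H$ disappears from the equation of motion. *)
Lemma mderiv_rotated s : s \in `[0, t] ->
  mderiv_within `[0, t] (fun u => E (- u) *m rho u *m E u) s
    (E (- s) *m diss s (rho s) *m E s).
Proof.
move=> st; have dE := mderiv_evol Vu HE `[0, t] s.
have dEN : mderiv_within `[0, t] (fun u => E (- u)) s ('i *: (E (- s) *m H)).
  rewrite (_ : (fun _ => _) = evol V (fun j => - h j)); last first.
    by apply/funext => u; rewrite evolN_opp.
  have := @mderiv_evol _ _ V Vu (fun j => - h j) _ erefl `[0, t] s.
  rewrite -evolN_opp (_ : eigen_conj _ _ = - H); last first.
    rewrite HE -scaleN1r eigen_conjZ; congr (eigen_conj _ _).
    by apply/matrixP => j k; rewrite !mxE rmorphN mulrnAr mulN1r.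
  (* Commuting [H] past the evolution gives the shape that [rotation_cancel] expects. *)
  by rewrite mulNmx scaleNr scalerN opprK (hamiltonian_evolC Vu HE).
have := mderivM (mderivM dEN (rho_sol st)) dE.
by rewrite /hamiltonian_part rotation_cancel.
Qed.

(** Integrate the derivative of the rotated solution over $[0,s]$, then rotate back by conjugating
    with [E s]. *)
Lemma solution_duhamel s : s \in `[0, t] ->
  rho s = E s *m rho 0 *m E (- s) + duhamel rho s.
Proof.
move=> st; have cr := mcontinuous_solution; rewrite duhamelE//.
have : 0 <= s by move: st; rewrite in_itv => /andP[].
rewrite le_eqVlt => /predU1P[<-|s0].
  by rewrite oppr0 op_integral_set1 mulmx0 mul0mx addr0 (evol0 Vu) mul1mx mulmx1.
have s0t := subset_itv0 st.
have cR : mcontinuous_within `[0, t] (fun u => E (- u) *m rho u *m E u).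
  exact: mderiv_mcontinuous mderiv_rotated.
rewrite (op_integral_FTC s0 (mcontinuous_withinW s0t cR)
  (mcontinuous_withinW s0t (mcontinuous_rotated cr))); last first.
  move=> u us; have us' : u \in `[0, s] by exact: subset_itv_oo_cc.
  exact: mderiv_withinW s0t (mderiv_rotated (s0t u us')).
rewrite oppr0 (evol0 Vu) mul1mx mulmx1 mulmxBr mulmxBl addrC.
have -> : E s *m (E (- s) *m rho s *m E s) *m E (- s) = rho s.
  by rewrite -rotation_expand (evolVr Vu) mulmx1 mul1mx.
by rewrite addrNK.
Qed.

Let delta n s := rho s - truncated_series H L gamma (rho 0) n s.

Let cdelta n : mcontinuous_within `[0, t] (delta n).
Proof.
by apply: mcontinuousB; [exact: mcontinuous_solution|exact: mcontinuous_truncated].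
Qed.

Lemma truncation_error0 s : s \in `[0, t] -> delta 0 s = duhamel rho s.
Proof.
move=> st; rewrite /delta {1}(solution_duhamel st) truncated_series0.
by rewrite addrC addKr.
Qed.

(** The solution and the truncation obey integral equations with the same zeroth-order term, which
    cancels in the difference. *)
Lemma truncation_errorS n s : s \in `[0, t] ->
  delta n.+1 s = duhamel (delta n) s.
Proof.
move=> st; rewrite /delta truncated_seriesS// opprD addrA.
rewrite -[rho s - _]/(delta 0 s) truncation_error0//; apply/eqP.
have cT := mcontinuous_truncated (rho 0) n.
(* The difference is handled by additivity alone, through $\rho = \delta_n + \tilde\rho_n$. *)
rewrite subr_eq -(duhamelD st (cdelta n) cT); apply/eqP; congr (duhamel _ s).
by apply/funext => u; rewrite /delta subrK.
Qed.

Context (rho_le1 : forall s, s \in `[0, t] -> trace_norm (rho s) <= 1).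

Lemma truncation_error_le (G : R) n s : s \in `[0, t] -> 0 <= G ->
  (forall u A, u \in `[0, t] -> trace_norm (diss u A) <= G * trace_norm A) ->
  trace_norm (delta n s) <= G ^+ n.+1 * s ^+ n.+1 / n.+1`!%:R.
Proof.
move=> + G0 dG; elim: n s => [|n IH] s st.
  (* The inserted [1] bounds the trace norm of $\rho(u)$, read as $1 \cdot u^0/0!$, so the base case
     is also one power step. *)
  rewrite truncation_error0// expr1 -[G in leRHS]mulr1.
  apply: (trace_norm_duhamel_pow st mcontinuous_solution dG G0) => u ut.
  by rewrite expr0 fact0 divr1 mulr1; exact: rho_le1.
rewrite truncation_errorS// (exprS G).
by apply: trace_norm_duhamel_pow => // u ut; exact: IH.
Qed.

Lemma truncation_error0_le (g : R -> R) : {within `[0, t], continuous g} ->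
  (forall u, u \in `[0, t] -> trace_norm (diss u (rho u)) <= g u) ->
  trace_norm (delta 0 t) <= \int[lebesgue_measure]_(u in `[0, t]) g u.
Proof.
have tt : t \in `[0, t] by rewrite in_itv /= lexx ltW.
move=> cg rg; rewrite truncation_error0//.
exact: (trace_norm_duhamel tt mcontinuous_solution).
Qed.

End Solution.

(** The norms at times $u$ and $s$ differ by at most [e u], the bound for the rate differences,
    which tends to 0 by continuity of the rates; a squeeze concludes. This makes the integrand in
    (a) integrable. *)
Lemma continuous_superop_norm_dissipator :
  {within `[0, t], continuous (fun s => superop_norm (diss s))}.
Proof.
apply/continuous_withinP => s st.
pose e u := diss_bound L (fun i => gamma i u - gamma i s).
have le_e u v (e' := diss_bound L (fun i => gamma i u - gamma i v)) :
    superop_norm (diss u) <= superop_norm (diss v) + e'.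
  apply: superop_normB_le; first exact: diss_bound_ge0.
    exact: trace_norm_dissipator.
  by move=> A; rewrite dissipatorB_rates; exact: trace_norm_dissipator.
have cgs (i : 'I_N) : gamma i u @[u --> within `[0, t] (nbhs s)] --> gamma i s.
  exact: ((continuous_withinP _ _).1 (@gamma_cont i) s st).
have es0 : e s = 0.
  by rewrite /e /diss_bound big1// => i _; rewrite subrr normr0 mul0r.
have e0 : e u @[u --> within `[0, t] (nbhs s)] --> (0 : R).
  rewrite -[X in _ --> X]es0.
  rewrite /e /diss_bound; apply: cvg_big => [|i _]; first exact: add_continuous.
  apply: cvgM; last exact: cvg_cst.
  apply: cvg_norm; apply: cvgB; last exact: cvg_cst.
  exact: cgs.
apply: (@squeeze_cvgr _ _ _ _ (fun u => superop_norm (diss s) - e u)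
  (fun u => superop_norm (diss s) + e u)).
- apply: nearW => u; rewrite le_e andbT lerBlDr; have := le_e s u.
  (* Absolute values make [e] symmetric in the two times, so one estimate gives both sides. *)
  by rewrite /e /diss_bound; under eq_bigr do rewrite distrC.
- by rewrite -[X in _ --> X]subr0; apply: cvgB => //; exact: cvg_cst.
- by rewrite -[X in _ --> X]addr0; apply: cvgD => //; exact: cvg_cst.
Qed.

End Fixed.
End Perturbation.

(** * Maximal rates *)

Lemma le_max_rate (R : realType) N (gamma : 'I_N -> R -> R) (t : R) i s :
  0 < t -> (forall i, {within `[0, t], continuous (gamma i)}) ->
  s \in `[0, t] -> `|gamma i s| <= max_rate gamma t.
Proof.
move=> t0 cg st; have N0 : (0 < N)%N by exact: leq_ltn_trans (leq0n i) (ltn_ord i).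
by have [_] := max_rate_attained N0 t0 cg; apply; exists i, s.
Qed.

Lemma exists_rate_argmax (R : realType) N (gamma : 'I_N -> R -> R) (t : R) :
  0 < t -> (forall i, {within `[0, t], continuous (gamma i)}) ->
  exists eps : 'I_N -> R, forall i, eps i \in `[0, t] /\
    forall s, s \in `[0, t] -> `|gamma i s| <= `|gamma i (eps i)|.
Proof.
move=> t0 cg; suff ex : forall i, exists s, s \in `[0, t] /\
    forall r, r \in `[0, t] -> `|gamma i r| <= `|gamma i s|.
  by have [eps epsP] := choice ex; exists eps.
move=> i.
have cng : {within `[0, t], continuous (fun s => `|gamma i s|)}.
  apply/continuous_withinP => s st; apply: cvg_norm.
  exact: ((continuous_withinP _ _).1 (cg i) s st).
by have [c ? ?] := EVT_max (ltW t0) cng; exists c.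
Qed.

(** * Derivation of the bounds (a) and (b) *)

Unset Implicit Arguments.
Local Close Scope complex_scope.
Local Close Scope sesquilinear_scope.

Theorem mainTheorem2 (R : realType) (d N : nat) (t : R) (H : 'M[R[i]]_d)
    (L : 'I_N -> 'M[R[i]]_d) (gamma : 'I_N -> R -> R) (rho : R -> 'M[R[i]]_d)
    (t_gt0 : 0 < t)
    (H_herm : H \is hermsymmx)
    (gamma_cont : forall i, {within `[0, t], continuous (gamma i)})
    (rho_sol : forall s, s \in `[0, t] ->
       op_has_derivative_within `[0, t] rho s
         (hamiltonian_part H (rho s) + dissipator L gamma s (rho s)))
    (rho_density : forall s, s \in `[0, t] -> density_operator (rho s)) :
  (exists eps : 'I_N -> R,
     (forall i, eps i \in `[0, t]) /\
     trace_dist (rho t) (truncated_series H L gamma (rho 0) 0 t)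
       <= 2^-1 * \int[lebesgue_measure]_(s in `[0, t])
            (superop_norm (dissipator L gamma s) * trace_norm (rho s))
       <= \sum_(i < N) `|gamma i (eps i)| * op_norm (L i) ^+ 2 * t)
  /\
  ((forall i, op_norm (L i) = 1) ->
   forall n : nat, exists eps : 'I_N -> 'I_n.+1 -> R,
     (forall i k, eps i k \in `[0, t]) /\
     trace_dist (rho t) (truncated_series H L gamma (rho 0) n t)
       <= (\prod_(k < n.+1) (2 * \sum_(i < N) `|gamma i (eps i k)|))
          * (t ^+ n.+1 / (2 * n.+1`!%:R))
       <= (2 * max_rate gamma t * N%:R * t) ^+ n.+1 / (2 * n.+1`!%:R)).
Proof.
have [V [Vu [h HE]]] := hermsym_eigen_conj H_herm.
have {}rho_sol s : s \in `[0, t] -> mderiv_within `[0, t] rho s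
    (hamiltonian_part H (rho s) + dissipator L gamma s (rho s)).
  by move=> /rho_sol/op_has_derivative_withinE.
have rho1 s : s \in `[0, t] -> trace_norm (rho s) = 1.
  by move=> /rho_density; exact: trace_norm_density.
have tt : t \in `[0, t] by rewrite in_itv /= lexx ltW.
(* Each point maximises its own rate in absolute value, so the constant [G] built from them controls
   the dissipator at all times. *)
have [eps epsP] := exists_rate_argmax t_gt0 gamma_cont.
pose G := diss_bound L (fun i => gamma i (eps i)).
have G0 : 0 <= G by exact: diss_bound_ge0.
have dG u A : u \in `[0, t] ->
    trace_norm (dissipator L gamma u A) <= G * trace_norm A.
  move=> ut; apply: le_trans (trace_norm_dissipator _ _ _ _) _.
  apply: ler_wpM2r; first exact: trace_norm_ge0.
  apply: ler_sum => i _; apply: ler_wpM2r; last exact: (epsP i).2.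
  by rewrite mulr_ge0// exprn_ge0// op_norm_ge0.
split.
  exists eps; split; first by move=> i; have [] := epsP i.
  have cg : {within `[0, t], continuous (fun s =>
      superop_norm (dissipator L gamma s) * trace_norm (rho s))}.
    (* On $[0,t]$ the factor $\|\rho(s)\|_1$ equals 1. *)
    apply: (@eq_continuous_within _ _ _ (fun s => superop_norm (dissipator L gamma s))).
      by move=> s st; rewrite rho1// mulr1.
    exact: continuous_superop_norm_dissipator.
  apply/andP; split.
    rewrite /trace_dist ler_wpM2l ?invr_ge0//.
    apply: (truncation_error0_le t_gt0 gamma_cont Vu HE rho_sol) cg _ => u _.
    by apply: le_superop_norm => A; exact: trace_norm_dissipator.
  (* The 2 moved to the right is the one contained in [diss_bound]. *)
  rewrite ler_pdivrMl//.
  (* The constant [G] is written as $G s^0/0!$ so that [Rintegral_pow] evaluates its integral. *)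
  apply: (@le_trans _ _ (\int[lebesgue_measure]_(s in `[0, t]) (G * s ^+ 0 / 0`!%:R))).
    apply: le_Rintegral => //; first exact: integrable_continuous_within.
      apply: integrable_continuous_within; apply: continuous_subspaceT => u.
      apply: cvgM; last exact: cvg_cst.
      by apply: cvgM; [exact: cvg_cst|exact: exprn_continuous].
    move=> u ut; rewrite rho1// mulr1 expr0 mulr1 divr1.
    by apply: superop_norm_le => // A; exact: dG.
  rewrite (Rintegral_pow _ _ (ltW t_gt0)) expr1 divr1 /G /diss_bound mulr_suml mulr_sumr.
  by apply: ler_sum => i _; rewrite le_eqVlt; apply/orP; left; apply/eqP; ring.
(* The same maximisers serve for every [k], so the product of brackets becomes a power. *)
move=> L1 n; exists (fun i _ => eps i); split; first by move=> i _; have [] := epsP i.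
set S := \sum_(i < N) `|gamma i (eps i)|.
have S0 : 0 <= S by apply: sumr_ge0.
have GE : G = 2 * S.
  rewrite /G /diss_bound /S mulr_sumr; apply: eq_bigr => i _.
  by rewrite L1 expr1n mulr1 mulrC.
have f0 : 0 < (n.+1`!%:R : R) by rewrite ltr0n fact_gt0.
have f20 : 0 < (2 * n.+1`!%:R : R) by rewrite mulr_gt0.
rewrite prodr_const card_ord; apply/andP; split.
  have := truncation_error_le t_gt0 gamma_cont Vu HE rho_sol _ n tt G0 dG.
  have r1 s : s \in `[0, t] -> trace_norm (rho s) <= 1 by move=> /rho1 ->.
  move=> /(_ r1) err; rewrite /trace_dist ler_pdivrMl//; apply: le_trans err _.
  rewrite GE le_eqVlt; apply/orP; left; apply/eqP; field.
  by rewrite lt0r_neq0.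
have t0 := ltW t_gt0.
(* Each of the [N] summands of [S] is at most [max_rate]. *)
have SM : 2 * S * t <= 2 * max_rate gamma t * N%:R * t.
  rewrite ler_wpM2r// -[leRHS]mulrA ler_wpM2l// mulr_natr.
  rewrite -[X in _ *+ X](card_ord N) -sumr_const; apply: ler_sum => i _.
  by apply: le_max_rate => //; exact: (epsP i).1.
rewrite mulrA -exprMn ler_wpM2r ?invr_ge0 ?(ltW f20)//.
by apply: lerXn2r => //; rewrite nnegrE ?(le_trans _ SM)// !mulr_ge0.
Qed.
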